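(* Let $\alpha$ be an ordinal of uncountable cofinality. Then $\mathscr{SZ}_\alpha$ has the factorization property; that is, every operator $T:E\to F$ between Banach spaces with $\mathrm{Sz}(T)\leqslant\omega^\alpha$ can be written as $T=BA$ with $A:E\to G$ and $B:G\to F$ operators and $G$ a Banach space with $\mathrm{Sz}(G)\leqslant\omega^\alpha$.
   Context: Banach spaces are over $\mathbb K\in\{\mathbb R,\mathbb C\}$; an operator is a bounded linear map between Banach spaces; $B_E$ is the closed unit ball of $E$; $T^*$ is the adjoint of $T$. Szlenk index. Let $E$ be a Banach space, $K\subseteq E^*$ a $w^*$-compact set and $\varepsilon>0$. Put $s_\varepsilon(K)=\{x\in K : \operatorname{diam}(K\cap V)>\varepsilon \text{ for every } w^*\text{-open } V\ni x\}$ (norm diameter), $s^0_\varepsilon(K)=K$, $s^{\alpha+1}_\varepsilon(K)=s_\varepsilon(s^\alpha_\varepsilon(K))$, and $s^\alpha_\varepsilon(K)=\bigcap_{\beta<\alpha}s^\beta_\varepsilon(K)$ for limit ordinals $\alpha$. $\mathrm{Sz}_\varepsilon(K)$ is the class of all ordinals $\alpha$ with $s^\alpha_\varepsilon(K)\neq\emptyset$; that is, the least ordinal $\alpha$ with $s^\alpha_\varepsilon(K)=\emptyset$ if one exists, and otherwise the class of all ordinals, written $\infty$. $\mathrm{Sz}(K)=\bigcup_{\varepsilon>0}\mathrm{Sz}_\varepsilon(K)=\sup_{\varepsilon>0}\mathrm{Sz}_\varepsilon(K)$. For a Banach space $E$, $\mathrm{Sz}(E)=\mathrm{Sz}(B_{E^*})$;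 for an operator $T:E\to F$, $\mathrm{Sz}(T)=\mathrm{Sz}(T^*B_{F^*})$. $\mathscr{SZ}_\alpha$ is the class of all operators $T$ with $\mathrm{Sz}(T)\leqslant\omega^\alpha$. An operator ideal $\mathscr I$ has the factorization property if every element of $\mathscr I$ factors (with bounded linear factors) through a Banach space whose identity operator belongs to $\mathscr I$. *)

(* Defs.v *)
From HB Require Import structures.
From mathcomp Require Import all_boot all_order all_algebra.
From mathcomp Require Import complex.
From mathcomp Require Import all_classical all_reals all_analysis.

Set Implicit Arguments.
Unset Strict Implicit.
Unset Printing Implicit Defensive.

Import Order.TTheory GRing.Theory Num.Theory.
Import numFieldNormedType.Exports.

Local Open Scope classical_set_scope.
Local Open Scope ring_scope.

(* Ordinals are coded by well-founded trees, [OSup i0 f] denoting the supremum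
   of the family [f].  Classically every ordinal has such a code (a limit is
   the supremum of all smaller ordinals), and two codes denote the same ordinal
   iff they are [ole] in both directions.  Families are nonempty (witness
   [i0]), so that the limit clauses of the recursions below, which are
   monotone in their ordinal argument, are correct for every [OSup], including
   a supremum that is attained. *)
Inductive Ord : Type :=
| OZero
| OSucc (a : Ord)
| OSup (X : Type) (i0 : X) (f : X -> Ord).

(* a + 1 <= b holds iff a < b, which is computed by recursion on b:
   a < b' + 1 iff a <= b', and a < sup_i f i iff a < f i for some i. *)
Fixpoint ole (a : Ord) : Ord -> Prop :=
  match a with
  | OZero => fun=> True
  | OSucc a' => fix lt (b : Ord) : Prop :=
      match b with
      | OZero => False
      | OSucc b' => ole a' b'
      | OSup X _ f => exists i : X, lt (f i)
      end
  | OSup X _ f => fun b => forall i : X, ole (f i) b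
  end.

Definition olt (a b : Ord) : Prop := ole (OSucc a) b.

Fixpoint oadd (a b : Ord) : Ord :=
  match b with
  | OZero => a
  | OSucc b' => OSucc (oadd a b')
  | OSup X i0 f => OSup i0 (fun i => oadd a (f i))
  end.

Fixpoint omul (a b : Ord) : Ord :=
  match b with
  | OZero => OZero
  | OSucc b' => oadd (omul a b') a
  | OSup X i0 f => OSup i0 (fun i => omul a (f i))
  end.

Definition omega : Ord := OSup 0%N (fun n : nat => iter n OSucc OZero).

Fixpoint omega_pow (b : Ord) : Ord :=
  match b with
  | OZero => OSucc OZero
  | OSucc b' => omul (omega_pow b') omega
  | OSup X i0 f => OSup i0 (fun i => omega_pow (f i))
  end.

Definition cofinal_family (I : Type) (f : I -> Ord) (a : Ord) : Prop :=
  (forall i, olt (f i) a) /\ (forall b, olt b a -> exists i, ole b (f i)).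

(* The index type may be empty, so 0 (like every successor) is excluded. *)
Definition uncountable_cofinality (a : Ord) : Prop :=
  forall (I : countType) (f : I -> Ord), ~ cofinal_family f a.

Variant scalar_kind := RealScalars | ComplexScalars.

Definition scalars (R : realType) (k : scalar_kind) : numFieldType :=
  match k with
  | RealScalars => R
  | ComplexScalars => R[i]%C
  end.

(* Norms in a [normedModType K] take values in K; this reads them in R. *)
Definition real_value (R : realType) (k : scalar_kind) : scalars R k -> R :=
  match k return scalars R k -> R with
  | RealScalars => fun x : R => x
  | ComplexScalars => fun z : R[i]%C => complex.Re z
  end.

Section Operators.
Context {K : numFieldType}.

Record operator (E F : normedModType K) := Operator {
  operator_fun :> {linear E -> F};
  operator_bounded : exists M : K, forall x, `|operator_fun x| <= M * `|x|
}.

Lemma op_id_bounded (E : normedModType K) :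
  exists M : K, forall x : E, `|idfun x| <= M * `|x|.
Proof. by exists 1 => x; rewrite mul1r. Qed.

Definition op_id (E : normedModType K) : operator E E :=
  @Operator E E idfun (op_id_bounded E).

Lemma op_comp_bounded (E F G : normedModType K)
    (S : operator F G) (T : operator E F) :
  exists M : K, forall x, `|(S \o T) x| <= M * `|x|.
Proof.
have [MS hS] := operator_bounded S; have [MT hT] := operator_bounded T.
exists (`|MS| * MT) => x /=; rewrite -mulrA.
apply: le_trans (ler_wpM2l (normr_ge0 MS) (hT x)).
have p : 0 <= MS * `|T x| by apply: le_trans (hS _).
by rewrite -[`|T x|]normr_id -normrM (ger0_norm p).
Qed.

Definition op_comp (E F G : normedModType K)
    (S : operator F G) (T : operator E F) : operator E G :=
  @Operator E G (S \o T) (op_comp_bounded S T).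

Definition dual (E : normedModType K) := operator E K^o.

HB.instance Definition _ (E : normedModType K) := gen_eqMixin (dual E).
HB.instance Definition _ (E : normedModType K) := gen_choiceMixin (dual E).

Definition adjoint (E F : normedModType K) (T : operator E F)
  (g : dual F) : dual E := op_comp g T.

Definition dual_eval (E : normedModType K) (f : dual E) : {ptws E -> K^o} :=
  fun x => f x.

Definition weak_star_topology (E : normedModType K) :=
  initial_topology (@dual_eval E).

Definition operator_class :=
  forall E F : completeNormedModType K, operator E F -> Prop.

Definition factorization_property (J : operator_class) : Prop :=
  forall (E F : completeNormedModType K) (T : operator E F), J E F T ->
  exists (G : completeNormedModType K) (A : operator E G) (B : operator G F),
    J G G (op_id G) /\ T = op_comp B A.

End Operators.

Section Szlenk.
Context {R : realType} {k : scalar_kind}.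
Local Notation K := (scalars R k).

Definition dual_norm (E : normedModType K) (f : E -> K) : R :=
  sup [set real_value `|f x| | x in [set x : E | `|x| <= 1]].

Definition dual_ball (E : normedModType K) : set (dual E) :=
  [set f | dual_norm f <= 1].

Definition diam (E : normedModType K) (S : set (dual E)) : \bar R :=
  ereal_sup [set (dual_norm (fun x => fg.1 x - fg.2 x))%:E | fg in S `*` S].

Definition szlenk_derivation (E : normedModType K) (eps : R)
    (S : set (dual E)) : set (dual E) :=
  [set f | S f /\ forall V : set (weak_star_topology E),
     open V -> V f -> (eps%:E < diam (S `&` V))%E].

Fixpoint szlenk_iter (E : normedModType K) (eps : R) (S : set (dual E))
    (a : Ord) : set (dual E) :=
  match a with
  | OZero => S
  | OSucc b => szlenk_derivation eps (szlenk_iter eps S b)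
  | OSup X _ u => [set f | forall i : X, szlenk_iter eps S (u i) f]
  end.

(* Szlenk indices are classes of ordinals: an index is either
   an ordinal (the class of its predecessors) or the class of all ordinals. *)
Definition Sz_eps (E : normedModType K) (eps : R) (S : set (dual E))
  (a : Ord) : Prop := szlenk_iter eps S a !=set0.

Definition Sz (E : normedModType K) (S : set (dual E)) (a : Ord) : Prop :=
  exists2 eps : R, 0 < eps & Sz_eps eps S a.

Definition Sz_space (E : normedModType K) : Ord -> Prop := Sz (@dual_ball E).

Definition Sz_operator (E F : normedModType K) (T : operator E F) :
  Ord -> Prop := Sz (adjoint T @` @dual_ball F).

Definition index_le (C : Ord -> Prop) (a : Ord) : Prop :=
  forall b, C b -> olt b a.

Definition SZ (a : Ord) : operator_class :=
  fun (E F : completeNormedModType K) (T : operator E F) =>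
    index_le (Sz_operator T) (omega_pow a).

End Szlenk.

Arguments SZ R k a : clear implicits.

(* Main.v *)
Require Import Defs.
From HB Require Import structures.
From mathcomp Require Import all_boot all_order all_algebra.
From mathcomp Require Import complex ring lra.
From mathcomp Require Import all_classical all_reals all_analysis.

Set Implicit Arguments.
Unset Strict Implicit.
Unset Printing Implicit Defensive.

Import Order.TTheory GRing.Theory Num.Theory.
Import numFieldNormedType.Exports.

Local Open Scope classical_set_scope.
Local Open Scope ring_scope.

(* Put [K = T^* B_{F^*}].  Since [alpha] has uncountable cofinality and the index
   of the compact set [K] at each [1/n] is a successor below [omega^alpha], a
   single [beta < alpha] satisfies [s_d^{omega^beta}(K) = 0] for every [d > 0].
   It then suffices to interpolate at the cost of one power of [omega].

   Let [M] be the set of sequences [h = (h_n)] in [F^*] with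
   [p(h) = sum_n max (2^-n |h_n|, 2^n |T^* h_n|) <= 1]; it is compact for the
   product of the weak-star topologies, and [h |-> sum_n T^* h_n] maps it
   continuously into [E^*].  [G] is the completion of [E] for the seminorm
   [sup_{h in M} |sum_n h_n (T x)|].  A Hilbert-space minimisation over finitely
   many coordinates shows that the dual ball of [G] is exactly the image of [M].
   If [p(h) <= r] and the first [N] terms of [p(h)] already exceed [r - s], the
   same holds near [h], tails have norm at most [s], and two such points at
   distance more than [3 s] in [G^*] have heads [T^* sum_{n < N} h_n] that are
   uniformly apart in [E^*].  Hence [omega^beta] derivations of
   [{p <= r}] end up in [{p <= r - s}], and [omega^beta * J] derivations
   exhaust [M] as soon as [J s > 1]; so [Sz G <= omega^(beta + 1)]. *)

(** * Ordinal codes *)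

(** The obstacle is uniformity. The number [N] of terms that carries all but [s] of the mass depends
    on the point of [M], and the separation [d] forced on the heads shrinks with [N], without a
    positive lower bound. So even for one fixed threshold on [G^*], knowing the index of [K] at a
    single [d] is of no use: one ordinal must exhaust [K] for all [d] at once. Uncountable
    cofinality provides it, since countably many [d] suffice by monotonicity and countably many
    exponents below [alpha] have a common bound below [alpha]. The further factor [omega] is
    harmless because [alpha] is a limit. The weights [2^-n] and [2^n] are those of real
    interpolation. Adding the terms, rather than taking their supremum, is what makes a head of mass
    at least [r - s] leave a tail of mass at most [s]. A lower bound on the mass is witnessed by
    finitely many values, so it is an open condition and persists near the point. *)

Lemma ole_supr (a : Ord) (X : Type) (i0 : X) (f : X -> Ord) (i : X) :
  ole a (f i) -> ole a (OSup i0 f).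
Proof.
elim: a => [|a IH|Y j0 g IH] //=; first by exists i.
by move=> h j; apply: IH; apply: h.
Qed.

Lemma ole_refl (a : Ord) : ole a a.
Proof. by elim: a => //= X i0 f IH i; apply: (@ole_supr _ _ _ _ i). Qed.

Lemma ole_trans (b a c : Ord) : ole a b -> ole b c -> ole a c.
Proof.
elim: a b c => [|a IH|X i0 f IH] b c //=; last first.
  by move=> h hbc i; apply: IH (h i) hbc.
elim: b c => [|b IHb|Y j0 g IHb] c //=.
- move=> hab; elim: c => [|c IHc|Z k0 h IHc] //=; first exact: IH hab.
  by move=> [i hi]; exists i; apply: IHc.
- by move=> [i hi] h; apply: IHb hi (h i).
Qed.

Lemma ole_succ (a : Ord) : ole a (OSucc a).
Proof.
elim: a => //= X i0 f IH i.
apply: ole_trans (IH i) _ => /=.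
exact: ole_supr (ole_refl _).
Qed.

Lemma oltW (a b : Ord) : olt a b -> ole a b.
Proof. by move=> h; apply: ole_trans (ole_succ a) h. Qed.

Lemma oleNgt (a b : Ord) : ~ ole a b -> olt b a.
Proof.
rewrite /olt.
elim: a b => [|a IH|X i0 f IH] b; first by case.
- elim: b => [|b IHb|Y j0 g IHb] //=; first exact: IH.
  move=> h i; apply: IHb => hi; apply: h; by exists i.
- by move=> /existsNP[i /IH hi]; exists i.
Qed.

Lemma oltnn (a : Ord) : ~ olt a a.
Proof.
rewrite /olt; elim: a => [|a IH|X i0 f IH] //= [i hi]; apply: (IH i).
apply: (@ole_trans (OSucc (OSup i0 f))) hi.
exact: (@ole_supr (f i) _ i0 f i (ole_refl _)).
Qed.

Lemma oadd_lel (a a' b : Ord) : ole a a' -> ole (oadd a b) (oadd a' b).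
Proof.
move=> h; elim: b => [|b IH|X i0 f IH] //= i.
exact: (@ole_supr _ _ _ _ i).
Qed.

Lemma oadd_ler (a b b' : Ord) : ole b b' -> ole (oadd a b) (oadd a b').
Proof.
elim: b b' => [|b IH|X i0 f IH] b' /=.
- move=> _; elim: b' => [|b' IHb|Y j0 g IHb] /=; first exact: ole_refl.
    exact: ole_trans IHb (ole_succ _).
  by apply: (@ole_supr _ _ _ _ j0); apply: IHb.
- elim: b' => [|b' IHb|Y j0 g IHb] //=; first exact: IH.
  by move=> [i hi]; exists i; apply: IHb.
- by move=> h i; apply: IH.
Qed.

Lemma omul_lel (a a' b : Ord) : ole a a' -> ole (omul a b) (omul a' b).
Proof.
move=> h; elim: b => [|b IH|X i0 f IH] //=.
  by apply: ole_trans (oadd_lel _ IH) (oadd_ler _ h).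
by move=> i; apply: (@ole_supr _ _ _ _ i).
Qed.

Lemma ole_omega_powS (a : Ord) : ole (omega_pow a) (omega_pow (OSucc a)).
Proof.
move=> /=; apply: (@ole_supr _ _ _ _ 1%N) => /=.
(* [omul x 1] unfolds to [oadd OZero x], so it remains to see that zero is neutral on the left. *)
by elim: (omega_pow a) => //= X i0 f IH i; apply: (@ole_supr _ _ _ _ i).
Qed.

Lemma omega_pow_gt0 (a : Ord) : ole (OSucc OZero) (omega_pow a).
Proof.
elim: a => [|a IH|X i0 f IH]; first exact: ole_refl.
  exact: ole_trans IH (ole_omega_powS a).
exact: (@ole_supr _ _ _ _ i0).
Qed.

Lemma ole_omega_pow (a b : Ord) : ole a b -> ole (omega_pow a) (omega_pow b).
Proof.
elim: a b => [|a IH|X i0 f IH] b; first by move=> _; exact: omega_pow_gt0.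
- elim: b => [|b IHb|Y j0 g IHb] // h.
    by move=> n; apply: (@ole_supr _ _ _ _ n); apply/omul_lel/IH.
  by case: h => i hi; apply: (@ole_supr _ _ _ _ i); apply: IHb.
- by move=> h i; apply: IH.
Qed.

(** A coarse Cantor normal form: omega^(a+1) is by construction the supremum of the multiples of
    omega^a by integers, so lying strictly below it is decided at some integer. The first
    alternative takes care of omega^0 = 1, which has no smaller power below it. *)
Lemma olt_omega_pow_dichotomy (a b : Ord) : olt b (omega_pow a) ->
  ole b OZero \/ exists g n,
    olt g a /\ ole b (omul (omega_pow g) (iter n OSucc OZero)).
Proof.
elim: a => [|a IH|X i0 f IH] h; first by left; exact: h.
  right; have [n hn] : exists n, olt b (omul (omega_pow a) (iter n OSucc OZero)).
    exact: h.
  by exists a, n; split; [exact: ole_refl|exact: oltW].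
have [i /IH[?|[g [n [hg hb]]]]] : exists i, olt b (omega_pow (f i)) by [].
  by left.
right; exists g, n; split => //; apply: ole_trans hg _.
exact: ole_supr (ole_refl _).
Qed.

Section UncountableCofinality.
Context {a : Ord} (ha : uncountable_cofinality a).

Lemma uncountable_cofinality_gt0 : olt OZero a.
Proof.
apply: contrapT => /oleNgt h.
have a0 : ole a OZero by exact: h.
apply: (ha (I := void) (f := fun _ => OZero)); split; first by case.
by move=> b hb; have := ole_trans hb a0.
Qed.

Lemma uncountable_cofinality_succ (b : Ord) : olt b a -> olt (OSucc b) a.
Proof.
move=> hb; apply: contrapT => /oleNgt h.
have a0 : ole a (OSucc b) by exact: h.
apply: (ha (I := unit) (f := fun _ => b)); split=> // c hc.
by exists tt; have := ole_trans hc a0.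
Qed.

Lemma uncountable_cofinality_bound (g : nat -> Ord) :
  (forall n, olt (g n) a) -> exists2 b, olt b a & forall n, ole (g n) b.
Proof.
move=> hg; apply: contrapT => h.
apply: (ha (I := nat) (f := g)); split=> // b hb.
apply: contrapT => /forallNP hn; apply: h; exists b => // n.
exact/oltW/oleNgt/hn.
Qed.

Lemma olt_omega_pow (b : Ord) : olt b (omega_pow a) ->
  exists2 g, olt g a & olt b (omega_pow g).
Proof.
move=> /olt_omega_pow_dichotomy[hb|[g [n [hg hb]]]].
  by exists OZero => //; exact: uncountable_cofinality_gt0.
exists (OSucc g); first exact: uncountable_cofinality_succ.
(* From b <= omega^g n one gets b + 1 <= omega^g n + omega^g = omega^g (n + 1). *)
apply: (@ole_supr _ _ _ _ n.+1).
apply: (@ole_trans (oadd (omul (omega_pow g) (iter n OSucc OZero)) (OSucc OZero))).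
  exact: hb.
exact/oadd_ler/omega_pow_gt0.
Qed.

End UncountableCofinality.

(** * Derivations of topological spaces *)

Section Derivation.
Context {X : topologicalType}.

(* [r x y] means that [x] and [y] are far apart. *)
Definition derivation (r : X -> X -> Prop) (S : set X) : set X :=
  [set x | S x /\ forall V : set X, open V -> V x ->
     exists y z, [/\ S y, V y, S z, V z & r y z]].

Fixpoint derived (r : X -> X -> Prop) (S : set X) (a : Ord) : set X :=
  match a with
  | OZero => S
  | OSucc b => derivation r (derived r S b)
  | OSup J _ u => [set x | forall i : J, derived r S (u i) x]
  end.

Implicit Types (r : X -> X -> Prop) (S : set X) (a b : Ord).

Lemma derivation_subset r S S' :
  S `<=` S' -> derivation r S `<=` derivation r S'.
Proof.
move=> h x [/h Sx hx]; split=> // V oV Vx.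
by have [y [z [/h ? ? /h ? ? ?]]] := hx V oV Vx; exists y, z.
Qed.

Lemma derived_subset r S S' a :
  S `<=` S' -> derived r S a `<=` derived r S' a.
Proof.
move=> h; elim: a => [|a IH|I i0 u IH] //=; first exact: derivation_subset.
by move=> x hx i; apply/IH/hx.
Qed.

Lemma derived_sub r S a : derived r S a `<=` S.
Proof.
elim: a => [|a IH|I i0 u IH] //=; first by apply: subset_trans IH => x [].
by move=> x /(_ i0)/IH.
Qed.

Lemma derived_antitone r S a b : ole a b -> derived r S b `<=` derived r S a.
Proof.
elim: a b => [|a IH|I i0 u IH] b; first by move=> _; exact: derived_sub.
- elim: b => [|b IHb|J j0 w IHb] //=.
    by move=> h; apply/derivation_subset/IH.
  by move=> [i hi] x /(_ i); exact: (IHb i hi).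
- by move=> h x hx i; apply: (IH _ _ (h i)).
Qed.

(** Turns [omul a J] derivations into [J] successive rounds of [a] derivations. *)
Lemma derived_oadd r S a b :
  derived r S (oadd a b) = derived r (derived r S a) b.
Proof.
elim: b => [|b IH|I i0 u IH] //=; first by rewrite IH.
by apply/seteqP; split => x /= hx i; have := hx i; rewrite IH.
Qed.

Lemma closed_derivation r S : closed S -> closed (derivation r S).
Proof.
move=> cS x hx; split.
  by apply: cS => U /hx[y [[Sy _] Uy]]; exists y.
move=> V oV Vx; have [|y [[_ hy] Vy]] := hx V; first exact: open_nbhs_nbhs.
exact: hy.
Qed.

Lemma closed_derived r S a : closed S -> closed (derived r S a).
Proof.
move=> cS; elim: a => [|a IH|I i0 u IH] //=; first exact: closed_derivation.
by move=> x hx i; apply: (IH i) => U /hx[y [hy Uy]]; exists y.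
Qed.

Lemma derived_chain r S a b :
  derived r S a `<=` derived r S b \/ derived r S b `<=` derived r S a.
Proof.
have [h|/oleNgt/oltW h] := pselect (ole a b); [right|left];
  exact: derived_antitone.
Qed.

Lemma compact_chain_bigcap (K : set X) (I : Type) (i0 : I) (C : I -> set X) :
  compact K -> (forall i, closed (C i)) ->
  (forall i j, C i `<=` C j \/ C j `<=` C i) ->
  (forall i, (K `&` C i) !=set0) -> exists2 x, K x & forall i, C i x.
Proof.
move=> cK cC chain ne.
pose F : set_system X := [set P | exists i, K `&` C i `<=` P].
have FF : ProperFilter F.
  split; last split.
  - by move=> [i hi]; have [x /hi] := ne i.
  - by exists i0.
  - move=> P Q [i hi] [j hj]; have [hij|hij] := chain i j; [exists i|exists j];
    by move=> x [Kx Cx]; split; [apply: hi|apply: hj]; split => //; apply: hij.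
  - by move=> P Q PQ [i hi]; exists i; apply: subset_trans PQ.
have [|x [Kx hx]] := cK F; first by exists i0; exact: subIset (or_introl _).
exists x => // i; apply: cC => U xU.
have [|y [[_ Ciy] Uy]] := hx (K `&` C i) U _ xU; first by exists i.
by exists y.
Qed.

(** At a limit stage nonempty closed subsets of a compact set, decreasing along a chain, have a
    common point; hence the first empty stage is a successor. This yields an index strictly below a
    limit ordinal from a mere upper bound. *)
Lemma derived_eq0_succ r S a : compact S -> closed S -> S !=set0 ->
  derived r S a = set0 -> exists2 b, olt b a & derived r S (OSucc b) = set0.
Proof.
move=> kS cS S0; elim: a => [|a IH|I i0 u IH].
- by move=> /= S_eq0; rewrite S_eq0 in S0; case: S0.
- by move=> h; exists a => //; exact: ole_refl.
- move=> h; have [[i hi]|/forallNP hne] :=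
    pselect (exists i, derived r S (u i) = set0).
    have [b hb hb0] := IH i hi; exists b => //.
    by apply: ole_trans hb _; exact: ole_supr (ole_refl _).
  have [x _ hx] : exists2 x, S x & forall i, derived r S (u i) x.
    apply: compact_chain_bigcap => // [i|i j|i].
    + exact: closed_derived.
    + exact: derived_chain.
    + by have /eqP/set0P[x hx] := hne i; exists x; split => //; exact: derived_sub hx.
  by have : set0 x by rewrite -h.
Qed.

End Derivation.

(** Derivation at a point of the open set [V] only looks at small neighbourhoods, so [f] has to
    preserve far pairs inside [V] alone. This locality is essential for the heads, which are kept
    apart only where the first [N] terms carry enough mass. *)
Lemma derived_transfer {X Y : topologicalType} (f : X -> Y)
    (r : X -> X -> Prop) (r' : Y -> Y -> Prop) (S V : set X) (S' : set Y)
    (a : Ord) :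
  continuous f -> open V -> (forall x, S x -> V x -> S' (f x)) ->
  (forall x y, S x -> V x -> S y -> V y -> r x y -> r' (f x) (f y)) ->
  forall x, derived r S a x -> V x -> derived r' S' a (f x).
Proof.
move=> cf oV SS' rr'; elim: a => [|a IH|I i0 u IH] x /=; first exact: SS'.
- move=> [Sx hx] Vx; split; first exact: IH.
  move=> W oW Wfx; have [| |y [z [Sy [Vy Wy] Sz [Vz Wz] ryz]]] :=
    hx (V `&` f @^-1` W).
  + by apply: openI => //; apply: open_comp => // y _; exact: cf.
  + by [].
  exists (f y), (f z); split=> //; [exact: IH|exact: IH|].
  by apply: rr' => //; apply: derived_sub; eassumption.
- by move=> hx Vx i; apply: IH.
Qed.

Section DerivedImage.
Context {X Y : topologicalType} (f : X -> Y).
Variables (r : X -> X -> Prop) (r' : Y -> Y -> Prop) (M : set X).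
Hypotheses (cf : continuous f) (hY : hausdorff_space Y) (kM : compact M).
Hypothesis (rr' : forall x x' z z', r' (f x) (f x') -> f z = f z' ->
  r x z \/ r z' x').

(** The hypothesis [rr'] is the triangle inequality when [r] is [r'] pulled back at half the
    distance. Pairs with far images accumulating at [y] cluster, by compactness, at some [(x, x')]
    lying over [y]. If both [x] and [x'] had neighbourhoods without far pairs, a far pair [(u, u')]
    close to [(x, x')] would contradict this, as [u] is far from [x] or [x'] from [u']. *)
Lemma derivation_image (S : set X) : S `<=` M -> closed S ->
  derivation r' (f @` S) `<=` f @` derivation r S.
Proof.
move=> SM cS y [_ hy].
have kS : compact S by exact: subclosed_compact SM.
pose F : set_system (X * X) := [set P | exists2 U, nbhs y U &
  forall x x', S x -> S x' -> U (f x) -> U (f x') -> r' (f x) (f x') -> P (x, x')].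
have FF : ProperFilter F.
  split; last split.
  - move=> [U]; rewrite nbhsE => -[V [oV Vy] VU] h.
    have [_ [_ [[x Sx <-] /VU Vx [x' Sx' <-] /VU Vx' rxx']]] := hy V oV Vy.
    exact: (h x x').
  - by exists setT => //; exact: filterT.
  - move=> P Q [U nU hU] [V nV hV]; exists (U `&` V); first exact: filterI.
    by move=> x x' Sx Sx' [? ?] [? ?] ?; split; [apply: hU|apply: hV].
  - by move=> P Q PQ [U nU hU]; exists U => // *; apply: PQ; apply: hU.
have [|[x x'] [[/= Sx Sx'] hx]] := @compact_setX X X S S kS kS F.
  by exists setT; [exact: filterT|move=> ? ? ? ? ? ? ?; split].
have fibre (z : X * X -> X) : continuous z ->
    (forall u, z u = u.1) \/ (forall u, z u = u.2) -> f (z (x, x')) = y.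
  move=> cz hz; apply: hY => A B nA nB.
  have FB : F [set u | B (f (z u))].
    by exists B => // u u' _ _ Bu Bu' _ /=; case: hz => ->.
  have nA' : nbhs (x, x') (z @^-1` (f @^-1` A)) by apply: cz; apply: cf.
  by have [u [Bu Au]] := hx _ _ FB nA'; exists (f (z u)).
have fx : f x = y by apply: (fibre fst) => [?|]; [exact: cvg_fst|left].
have fx' : f x' = y by apply: (fibre snd) => [?|]; [exact: cvg_snd|right].
have [hdx|hdx] := pselect (derivation r S x); first by exists x.
have [hdx'|hdx'] := pselect (derivation r S x'); first by exists x'.
have far z : S z -> ~ derivation r S z -> exists V, [/\ open V, V z &
    forall u v, S u -> V u -> S v -> V v -> ~ r u v].
  move=> Sz hz; apply: contrapT => /forallNP h; apply: hz; split=> // V oV Vz.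
  apply: contrapT => h'; apply: (h V); split=> // u v Su Vu Sv Vv ruv.
  by apply: h'; exists u, v.
have [V [oV Vx hV]] := far x Sx hdx.
have [V' [oV' Vx' hV']] := far x' Sx' hdx'.
have Ffar : F [set u | [/\ S u.1, S u.2 & r' (f u.1) (f u.2)]].
  by exists setT => //; exact: filterT.
have nVV' : nbhs (x, x') (V `*` V').
  by exists (V, V') => //; split; exact: open_nbhs_nbhs.
have [[u u'] [[/= Su Su' ruu'] [/= Vu Vu']]] := hx _ _ Ffar nVV'.
have [h|h] := rr' ruu' (etrans fx (esym fx')).
  by case: (hV u x).
by case: (hV' x' u').
Qed.

Lemma derived_image (a : Ord) : closed M ->
  derived r' (f @` M) a `<=` f @` derived r M a.
Proof.
move=> cM; elim: a => [|a IH|I i0 u IH] //=.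
  apply: subset_trans (derivation_image _ _); last exact: closed_derived.
    exact: derivation_subset.
  exact: derived_sub.
(* At a limit stage the preimages of [y] found so far may vary with the stage; compactness of the
   fibre gives a common one. *)
move=> y hy; pose C i := derived r M (u i) `&` f @^-1` [set y].
have [i|i j|i|x _ hx] := @compact_chain_bigcap X M I i0 C kM.
- apply: closedI; first exact: closed_derived.
  apply: closed_comp => [? _|]; first exact: cf.
  exact/accessible_closed_set1/hausdorff_accessible.
- by have [h|h] := derived_chain r M (u i) (u j); [left|right]; exact: setSI.
- have [x hx fx] := IH i y (hy i); exists x; split; last by split.
  exact: derived_sub hx.
- exists x; [by move=> i; have [] := hx i|by have [] := hx i0].
Qed.

End DerivedImage.

(** * Real-valued moduli of scalars and vectors *)

Section Scalars.
Context {R : realType} {k : scalar_kind}.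
Local Notation K := (scalars R k).
Implicit Types (r s : R) (z w : K).

Definition of_real : R -> K :=
  match k return R -> scalars R k with
  | RealScalars => fun x : R => x
  | ComplexScalars => fun x : R => (x%:C)%C
  end.

Definition scalar_conj : K -> K :=
  match k return scalars R k -> scalars R k with
  | RealScalars => fun x : R => x
  | ComplexScalars => fun z : R[i]%C => (z^*)%C
  end.

Definition imaginary_value : K -> R :=
  match k return scalars R k -> R with
  | RealScalars => fun=> 0
  | ComplexScalars => fun z : R[i]%C => complex.Im z
  end.

(* The junk value [0] over the reals keeps [scalarE] below uniform. *)
Definition imaginary_unit : K :=
  match k return scalars R k with
  | RealScalars => (0 : R)
  | ComplexScalars => 'i%C
  end.

Lemma of_real_is_zmod_morphism : zmod_morphism of_real.
Proof. by rewrite /of_real; case: k => x y //; exact: rmorphB. Qed.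

Lemma of_real_is_monoid_morphism : monoid_morphism of_real.
Proof. by rewrite /of_real; case: k; split=> // x y; exact: rmorphM. Qed.

HB.instance Definition _ :=
  GRing.isZmodMorphism.Build R K of_real of_real_is_zmod_morphism.
HB.instance Definition _ :=
  GRing.isMonoidMorphism.Build R K of_real of_real_is_monoid_morphism.

Lemma of_realD r s : of_real (r + s) = of_real r + of_real s.
Proof. exact: rmorphD. Qed.

Lemma of_realM r s : of_real (r * s) = of_real r * of_real s.
Proof. exact: rmorphM. Qed.

Lemma of_real0 : of_real 0 = 0.
Proof. exact: rmorph0. Qed.

Lemma of_real1 : of_real 1 = 1.
Proof. exact: rmorph1. Qed.

Lemma real_value_is_zmod_morphism : zmod_morphism (@real_value R k).
Proof. by rewrite /real_value; case: k => x y //; case: x => ? ?; case: y. Qed.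

HB.instance Definition _ :=
  GRing.isZmodMorphism.Build K R (@real_value R k) real_value_is_zmod_morphism.

Lemma real_valueK : cancel of_real (@real_value R k).
Proof. by rewrite /of_real /real_value; case: k. Qed.

Lemma real_valueZ r z : real_value (of_real r * z) = r * real_value z.
Proof.
rewrite /of_real /real_value; case: k z => //= -[a b] /=.
by rewrite mul0r subr0.
Qed.

Lemma le_of_real r s : (of_real r <= of_real s) = (r <= s).
Proof. by rewrite /of_real; case: k => //=; rewrite lecR. Qed.

Lemma lt_of_real r s : (of_real r < of_real s) = (r < s).
Proof. by rewrite /of_real; case: k => //=; rewrite ltcR. Qed.

Lemma ger0_of_real z : 0 <= z -> z = of_real (real_value z).
Proof.
rewrite /of_real /real_value; case: k z => //= -[a b] z0.
by move: (ger0_Im z0) => /= ->.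
Qed.

(** The norm takes values in [K], which is only partially ordered in the complex case; its real copy
    can be used in suprema and linear arithmetic. *)
Definition modulus {V : normedZmodType K} (x : V) : R := real_value `|x|.

Lemma normE (V : normedZmodType K) (x : V) : `|x| = of_real (modulus x).
Proof. exact: ger0_of_real. Qed.

Lemma norm_le (V : normedZmodType K) (x : V) r :
  (`|x| <= of_real r) = (modulus x <= r).
Proof. by rewrite normE le_of_real. Qed.

Lemma norm_lt (V : normedZmodType K) (x : V) (e : K) : 0 < e ->
  (`|x| < e) = (modulus x < real_value e).
Proof. by move=> e0; rewrite normE {1}(ger0_of_real (ltW e0)) lt_of_real. Qed.

Lemma real_value_gt0 z : 0 < z -> 0 < real_value z.
Proof. by move=> z0; rewrite -lt_of_real of_real0 -ger0_of_real// ltW. Qed.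

Lemma norm_le1 (V : normedZmodType K) (x : V) : (`|x| <= 1) = (modulus x <= 1).
Proof. by rewrite -norm_le of_real1. Qed.

Lemma modulus_ge0 (V : normedZmodType K) (x : V) : 0 <= modulus x.
Proof. by rewrite -le_of_real -normE of_real0. Qed.

Lemma modulus0 (V : normedZmodType K) : modulus (0 : V) = 0.
Proof. by rewrite /modulus normr0 raddf0. Qed.

Lemma modulus_eq0 (V : normedZmodType K) (x : V) : modulus x = 0 -> x = 0.
Proof. by move=> h; apply/eqP; rewrite -normr_eq0 normE h of_real0. Qed.

Lemma ler_modulusD (V : normedZmodType K) (x y : V) :
  modulus (x + y) <= modulus x + modulus y.
Proof. by rewrite -le_of_real of_realD -!normE ler_normD. Qed.

Lemma modulusN (V : normedZmodType K) (x : V) : modulus (- x) = modulus x.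
Proof. by rewrite /modulus normrN. Qed.

Lemma modulus_distC (V : normedZmodType K) (x y : V) :
  modulus (x - y) = modulus (y - x).
Proof. by rewrite -modulusN opprB. Qed.

Lemma ler_modulusB (V : normedZmodType K) (x y : V) :
  modulus (x - y) <= modulus x + modulus y.
Proof. by rewrite -(modulusN y) ler_modulusD. Qed.

Lemma ler_dist_modulus (V : normedZmodType K) (x y : V) :
  `|modulus x - modulus y| <= modulus (x - y).
Proof.
have h (u v : V) : modulus u - modulus v <= modulus (u - v).
  by rewrite lerBlDr -{1}(subrK v u) ler_modulusD.
by rewrite ler_norml lerNl opprB h andbT modulus_distC h.
Qed.

Lemma modulusM z w : modulus (z * w) = modulus z * modulus w.
Proof.
by rewrite {1}/modulus normrM !normE -of_realM real_valueK.
Qed.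

Lemma modulusZ (V : normedModType K) z (x : V) :
  modulus (z *: x) = modulus z * modulus x.
Proof. by rewrite {1}/modulus normrZ !normE -of_realM real_valueK. Qed.

Lemma modulus_of_real r : modulus (of_real r) = `|r|.
Proof.
rewrite /modulus /of_real /real_value; case: k => //=.
by rewrite expr0n addr0 sqrtr_sqr.
Qed.

Lemma modulus_of_real_ge0 r : 0 <= r -> modulus (of_real r) = r.
Proof. by move=> r0; rewrite modulus_of_real ger0_norm. Qed.

Lemma modulus1 : modulus (1 : K) = 1.
Proof. by rewrite -of_real1 modulus_of_real normr1. Qed.

Lemma norm_real_value z : `|real_value z| <= modulus z.
Proof.
rewrite /modulus /real_value; case: k z => //= -[a b] /=.
by rewrite -[leLHS]sqrtr_sqr ler_wsqrtr// lerDl sqr_ge0.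
Qed.

Lemma norm_imaginary_value z : `|imaginary_value z| <= modulus z.
Proof.
rewrite /modulus /imaginary_value /real_value; case: k z => /= [z|[a b] /=].
  by rewrite normr0.
by rewrite -[leLHS]sqrtr_sqr ler_wsqrtr// lerDr sqr_ge0.
Qed.

Lemma scalarE z :
  z = of_real (real_value z) + imaginary_unit * of_real (imaginary_value z).
Proof.
rewrite /of_real /imaginary_unit /imaginary_value /real_value.
by case: k z => /= [z|z]; [rewrite mul0r addr0|exact: complexE].
Qed.

Lemma modulus_conj_square z : of_real (modulus z ^+ 2) = scalar_conj z * z.
Proof.
rewrite expr2 of_realM -normE -expr2 /scalar_conj; case: k z => /= z.
  by rewrite real_normK ?num_real// expr2.
by rewrite sqr_normc mulrC.
Qed.

Lemma modulus_squareD z w : modulus (z + w) ^+ 2 =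
  modulus z ^+ 2 + 2 * real_value (scalar_conj z * w) + modulus w ^+ 2.
Proof.
rewrite /modulus /scalar_conj /real_value; case: k z w => /= z w.
  by rewrite !real_normK ?num_real//; ring.
case: z w => [a b] [c d] /=; rewrite !sqr_sqrtr ?addr_ge0 ?sqr_ge0//.
by ring.
Qed.

Lemma scalar_phase z : exists c : K, modulus c <= 1 /\ c * z = of_real (modulus z).
Proof.
have [->|z0] := eqVneq z 0.
  (* Asking only for modulus at most 1 lets 0 serve as the phase of 0. *)
  by exists 0; rewrite modulus0 mul0r of_real0.
have mz : modulus z != 0 by apply: contra_neq z0 => /modulus_eq0.
exists (of_real ((modulus z)^-1) * scalar_conj z); split; last first.
  by rewrite -mulrA -modulus_conj_square -of_realM expr2 mulKf.
rewrite modulusM modulus_of_real normfV (ger0_norm (modulus_ge0 _)).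
have <- : modulus z = modulus (scalar_conj z).
  rewrite /modulus /scalar_conj; case: k z {z0 mz} => [//|z].
  exact: (congr1 (@complex.Re R) (esym (normcJ z))).
by rewrite mulVf.
Qed.

End Scalars.

(** * Neighbourhoods, compactness and completeness in terms of the modulus *)

Section ScalarTopology.
Context {R : realType} {k : scalar_kind}.
Local Notation K := (scalars R k).

Lemma nbhs_modulusP (V : normedModType K) (x : V) (A : set V) :
  nbhs x A <-> exists2 e : R, 0 < e & forall y, modulus (y - x) < e -> A y.
Proof.
split=> [/nbhs_normP[e /= e0 xA]|[e e0 h]].
  exists (real_value e); first exact: real_value_gt0.
  by move=> y hy; apply: xA; rewrite /= distrC norm_lt.
have e0' : 0 < of_real e :> K by rewrite -(of_real0 (k := k)) lt_of_real.
apply/nbhs_normP; exists (of_real e) => // y /=.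
by rewrite distrC norm_lt// real_valueK => /h.
Qed.

Lemma ball_modulus (V : normedModType K) (x y : V) (e : K) : 0 < e ->
  ball x e y <-> modulus (y - x) < real_value e.
Proof. by move=> e0; rewrite -ball_normE /= distrC norm_lt. Qed.

Lemma cauchy_modulusP (V : normedModType K) (F : set_system V) {FF : ProperFilter F} :
  cauchy F <->
  forall e : R, 0 < e -> exists x, F [set y | modulus (y - x) < e].
Proof.
split=> [/cauchyP cF e e0|h].
  have e0' : 0 < of_real e :> K by rewrite -(of_real0 (k := k)) lt_of_real.
  have [x hx] := cF _ e0'; exists x; apply: filterS hx => y.
  by move/(ball_modulus _ _ e0'); rewrite real_valueK.
apply/cauchyP => e e0; have [x hx] := h _ (real_value_gt0 e0).
by exists x; apply: filterS hx => y hy; apply/(ball_modulus _ _ e0).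
Qed.

Lemma cvg_modulusP (V : normedModType K) (F : set_system V) {FF : Filter F} (x : V) :
  F --> x <-> forall e : R, 0 < e -> F [set y | modulus (y - x) < e].
Proof.
split=> [Fx e e0|h]; first by apply: Fx; apply/nbhs_modulusP; exists e.
by move=> A /nbhs_modulusP[e e0 xA]; apply: filterS (h e e0).
Qed.

Lemma continuous_lipschitz1 (V : normedModType K) (g : V -> R) :
  (forall z w, `|g z - g w| <= modulus (z - w)) -> continuous g.
Proof.
move=> h z; apply/cvgrPdist_lt => e e0; apply/nbhs_modulusP.
by exists e => // w; apply: le_lt_trans; rewrite distrC h.
Qed.

Lemma continuous_modulus (V : normedModType K) : continuous (@modulus R k V).
Proof. by apply: continuous_lipschitz1 => z w; exact: ler_dist_modulus. Qed.

Lemma continuous_of_real : continuous (@of_real R k : R -> K^o).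
Proof.
move=> x A /nbhs_modulusP[e e0 h]; apply/nbhs_ballP; exists e => // y /= xy.
apply: h.
have -> : (of_real y : K^o) - of_real x = of_real (y - x) :> K.
  by rewrite -[RHS]/(@of_real R k (y - x)) of_realD -(rmorphN of_real).
by rewrite modulus_of_real distrC.
Qed.

Lemma compact_scalar_ball (c : R) : compact [set z : K^o | modulus z <= c].
Proof.
(* The ball is a closed part of the image of a square under (s, t) |-> s + i t; over the reals
   [imaginary_unit] is 0 and t is ignored. *)
pose f (p : R * R) : K^o :=
  (of_real p.1 : K^o) + (imaginary_unit : K) *: (of_real p.2 : K^o).
have cf : continuous f.
  move=> p; apply: cvgD.
    by apply: (@continuous_comp _ _ _ fst); [exact: cvg_fst|exact: continuous_of_real].
  apply: cvgZr; apply: (@continuous_comp _ _ _ snd); first exact: cvg_snd.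
  exact: continuous_of_real.
have kf : compact (f @` (`[- c, c]%classic `*` `[- c, c]%classic)).
  apply: continuous_compact; first exact: continuous_subspaceT.
  by apply: compact_setX; exact: segment_compact.
apply: subclosed_compact kf _.
  apply: (@closed_comp _ _ (@modulus R k K^o) [set x | x <= c]).
    by move=> z _; exact: continuous_modulus.
  exact: closed_le.
move=> z /= zc; exists (real_value z, imaginary_value z).
  by split; rewrite /= in_itv /= -ler_norml (le_trans _ zc)// ?norm_real_value ?norm_imaginary_value.
by rewrite /f /= [RHS]scalarE.
Qed.

Lemma scalar_complete (F : set_system K^o) :
  ProperFilter F -> cauchy F -> cvg F.
Proof.
move=> FF cF.
have h : cauchy_ex F by exact/(cauchyP F).
have [x hx] := h 1 ltr01.
have FU : F [set z | modulus z <= modulus x + 1].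
  apply: filterS hx => y; rewrite -ball_normE /= => /ltW; rewrite norm_le1 => hy.
  rewrite addrC; apply: le_trans (lerD hy (lexx _)).
  by rewrite modulus_distC -{1}(subrK x y) ler_modulusD.
exact: compact_cauchy_cvg FF cF FU (@compact_scalar_ball _).
Qed.

End ScalarTopology.

Lemma compact_box (R : realType) (k : scalar_kind) (Z : eqType) (c : Z -> R) :
  compact [set m : {ptws Z -> (scalars R k)^o} | forall z, modulus (m z) <= c z].
Proof.
apply: (@tychonoff Z (fun=> (scalars R k)^o) (fun z => [set u | modulus u <= c z])).
by move=> z; exact: compact_scalar_ball.
Qed.

Lemma continuous_ptws_eval (Z : choiceType) (T : topologicalType) (z : Z) :
  continuous (fun m : {ptws Z -> T} => m z).
Proof. exact: proj_continuous. Qed.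

Section ClosedConditions.
Context {R : realType} {k : scalar_kind} {T : topologicalType}.
Local Notation K := (scalars R k).

Lemma closed_forall (J : Type) (C : J -> set T) :
  (forall j, closed (C j)) -> closed [set t | forall j, C j t].
Proof.
by move=> cC t ht j; apply: cC => U /ht[y [hy Uy]]; exists y; split=> //; exact: hy.
Qed.

Lemma closed_imply (P : Prop) (C : set T) :
  closed C -> closed [set t | P -> C t].
Proof.
by move=> cC t ht p; apply: cC => U /ht[y [hy Uy]]; exists y; split=> //; exact: hy.
Qed.

Lemma closed_le_continuous (f : T -> R) (c : R) :
  continuous f -> closed [set t | f t <= c].
Proof.
move=> cf; apply: (@closed_comp _ _ f [set x | x <= c]); last exact: closed_le.
by move=> t _; exact: cf.
Qed.

Lemma open_gt_continuous (f : T -> R) (c : R) :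
  continuous f -> open [set t | c < f t].
Proof.
move=> cf; apply: (@open_comp _ _ f [set x | c < x]); last exact: open_gt.
by move=> t _; exact: cf.
Qed.

Lemma continuous_modulus_comp (f : T -> K^o) :
  continuous f -> continuous (fun t => modulus (f t)).
Proof. by move=> cf t; apply: continuous_comp; [exact: cf|exact: continuous_modulus]. Qed.

Lemma continuous_scalarD (f g : T -> K^o) :
  continuous f -> continuous g -> continuous (fun t => f t + g t : K^o).
Proof. by move=> cf cg t; apply: cvgD; [exact: cf|exact: cg]. Qed.

Lemma continuous_scalarM (c : K) (f : T -> K^o) :
  continuous f -> continuous (fun t => c * f t : K^o).
Proof. by move=> cf t; apply: cvgZr; exact: cf. Qed.

Lemma continuous_scalarB (f g : T -> K^o) :
  continuous f -> continuous g -> continuous (fun t => f t - g t : K^o).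
Proof. by move=> cf cg t; apply: cvgB; [exact: cf|exact: cg]. Qed.

Lemma continuous_scalar_sum n (f : nat -> T -> K^o) :
  (forall i, continuous (f i)) -> continuous (fun t => \sum_(i < n) f i t : K^o).
Proof.
move=> cf; elim: n => [|n IH].
  under eq_fun do rewrite big_ord0; by move=> t; exact: cvg_cst.
under eq_fun do rewrite big_ord_recr /=.
exact: continuous_scalarD.
Qed.

Lemma continuous_realD (f g : T -> R) :
  continuous f -> continuous g -> continuous (fun t => f t + g t).
Proof. by move=> cf cg t; apply: cvgD; [exact: cf|exact: cg]. Qed.

Lemma continuous_real_sum n (f : nat -> T -> R) :
  (forall i, continuous (f i)) -> continuous (fun t => \sum_(i < n) f i t).
Proof.
move=> cf; elim: n => [|n IH].
  under eq_fun do rewrite big_ord0; by move=> t; exact: cvg_cst.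
under eq_fun do rewrite big_ord_recr /=.
by move=> t; apply: cvgD; [exact: IH|exact: cf].
Qed.

Lemma closed_eq_continuous (f g : T -> K^o) :
  continuous f -> continuous g -> closed [set t | f t = g t].
Proof.
move=> cf cg; rewrite (_ : mkset _ = [set t | modulus (f t - g t) <= 0]).
  exact/closed_le_continuous/continuous_modulus_comp/continuous_scalarB.
apply/seteqP; split=> t /= [].
  by move=> ->; rewrite subrr modulus0.
move=> h; apply/eqP; rewrite -subr_eq0; apply/eqP/modulus_eq0/le_anti.
by rewrite h modulus_ge0.
Qed.

End ClosedConditions.

(** * Operators and the weak-star topology *)

Section BoundedOperators.
Context {R : realType} {k : scalar_kind}.
Local Notation K := (scalars R k).
Implicit Types E F : normedModType K.

Lemma operator_ext E F (S T : operator E F) : S =1 T -> S = T.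
Proof.
case: S T => [[f cf] hS] [[g cg] hT] /= /funext fg; case: _ / fg in cg hT *.
case: cf hS => [[m1] [m2]] hS; case: cg hT => [[m3] [m4]] hT.
move: hS hT; rewrite (Prop_irrelevance m1 m3) (Prop_irrelevance m2 m4) => hS hT.
by congr Operator; exact: Prop_irrelevance.
Qed.

Lemma operator_modulus_bound E F (T : operator E F) :
  exists2 c : R, 0 <= c & forall x, modulus (T x) <= c * modulus x.
Proof.
have [M hM] := operator_bounded T.
exists (modulus M); first exact: modulus_ge0.
move=> x; rewrite -norm_le (le_trans (hM x))//.
have p : 0 <= M * `|x| := le_trans (normr_ge0 _) (hM x).
rewrite (ger0_of_real p) le_of_real (le_trans (ler_norm _))//.
by rewrite (le_trans (norm_real_value _))// modulusM [modulus `|x|]/modulus normr_id.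
Qed.

Lemma operator_exists E F (f : E -> F) (c : R) : linear f ->
  (forall x, modulus (f x) <= c * modulus x) ->
  exists T : operator E F, forall x, T x = f x.
Proof.
move=> lf hf.
pose m := GRing.isLinear.Build K E F *:%R f lf.
pose g : {linear E -> F} := HB.pack f m.
have hg : exists M : K, forall x, `|g x| <= M * `|x|.
  by exists (of_real c) => x; rewrite (normE x) -of_realM norm_le; exact: hf.
by exists (Operator hg).
Qed.

End BoundedOperators.

Section Dual.
Context {R : realType} {k : scalar_kind} {E : normedModType (scalars R k)}.
Local Notation K := (scalars R k).

Lemma dual_norm_le (f : E -> K) (c : R) :
  (forall x, modulus x <= 1 -> modulus (f x) <= c) -> dual_norm f <= c.
Proof.
move=> h; apply: ge_sup.
  by exists (modulus (f 0)), 0 => //=; rewrite norm_le1 modulus0.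
by move=> _ [x /= x1 <-]; apply: h; rewrite -norm_le1.
Qed.

(** The constant [c] guarantees that the supremum is over a bounded set and so is not a default
    value. *)
Lemma le_dual_norm (f : E -> K) (c : R) (x : E) :
  (forall x, modulus x <= 1 -> modulus (f x) <= c) ->
  modulus x <= 1 -> modulus (f x) <= dual_norm f.
Proof.
move=> h x1; apply: ub_le_sup.
  by exists c => _ [y /= y1 <-]; apply: h; rewrite -norm_le1.
by exists x => //=; rewrite norm_le1.
Qed.

Lemma modulus_scale_le (g : E -> R) (c : R) :
  (forall (r : R) x, 0 < r -> g (of_real r *: x) = r * g x) ->
  g 0 <= 0 ->
  (forall x, modulus x <= 1 -> g x <= c) ->
  forall x, g x <= c * modulus x.
Proof.
move=> gZ g0 h x; have [->|x0] := eqVneq x 0; first by rewrite modulus0 mulr0.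
have mx : 0 < modulus x.
  rewrite lt_neqAle modulus_ge0 andbT eq_sym.
  by apply: contra_neq x0 => /modulus_eq0.
rewrite -ler_pdivrMr// mulrC -gZ ?invr_gt0//; apply: h.
by rewrite modulusZ modulus_of_real gtr0_norm ?invr_gt0// mulVf ?gt_eqF.
Qed.

Lemma linear_modulus_scale_le (f : E -> K) (c : R) :
  (forall (r : R) x, f (of_real r *: x) = of_real r * f x) ->
  (forall x, modulus x <= 1 -> modulus (f x) <= c) ->
  forall x, modulus (f x) <= c * modulus x.
Proof.
move=> fZ h; apply: modulus_scale_le => // [r x r0|].
  by rewrite fZ modulusM modulus_of_real gtr0_norm.
by rewrite -(scale0r 0) -(of_real0 (k := k)) fZ of_real0 mul0r modulus0.
Qed.

Lemma dual_ballP (f : dual E) :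
  dual_ball f <-> forall x, modulus (f x) <= modulus x.
Proof.
have [c c0 hc] := operator_modulus_bound f.
have hc1 x : modulus x <= 1 -> modulus (f x) <= c.
  by move=> x1; apply: le_trans (hc x) _; rewrite ler_piMr.
split=> [f1 x|h]; last by apply: dual_norm_le => x; apply: le_trans (h x).
rewrite -[leRHS]mul1r; apply: linear_modulus_scale_le => [r y|y y1].
  by rewrite linearZ.
exact: le_trans (le_dual_norm hc1 y1) f1.
Qed.

Lemma dual_norm_sub_bound (f g : dual E) : exists c : R, forall x,
  modulus x <= 1 -> modulus (f x - g x) <= c.
Proof.
have [c c0 hc] := operator_modulus_bound f.
have [d d0 hd] := operator_modulus_bound g.
exists (c + d) => x x1; apply: le_trans (ler_modulusB _ _) _.
by apply: lerD; [apply: le_trans (hc x) _|apply: le_trans (hd x) _]; rewrite ler_piMr.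
Qed.

Lemma le_dual_norm_sub (f g : dual E) (x : E) : modulus x <= 1 ->
  modulus (f x - g x) <= dual_norm (fun y => f y - g y).
Proof.
move=> x1; have [c hc] := dual_norm_sub_bound f g.
exact: (@le_dual_norm (fun y => f y - g y) c).
Qed.

Lemma dual_norm_sub_triangle (f g h : dual E) :
  dual_norm (fun x => f x - h x) <=
  dual_norm (fun x => f x - g x) + dual_norm (fun x => g x - h x).
Proof.
apply: dual_norm_le => x x1.
rewrite -(subrKA (g x) (f x)) (le_trans (ler_modulusD _ _))// lerD//.
  exact: le_dual_norm_sub.
exact: le_dual_norm_sub.
Qed.

Definition far (e : R) (f g : weak_star_topology E) : Prop :=
  e < dual_norm (fun x => (f : dual E) x - (g : dual E) x).

(** A supremum strictly exceeds [e] iff one of its members does, so the diameter can be replaced by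
    a pair of points. *)
Lemma szlenk_derivationE (e : R) (S : set (dual E)) :
  szlenk_derivation e S = derivation (far e) (S : set (weak_star_topology E)).
Proof.
apply/seteqP; split=> f [Sf hf]; split=> // V oV Vf.
  have /ereal_sup_gt[_ [[g h] /= [[Sg Vg] [Sh Vh]] <-]] := hf V oV Vf.
  by rewrite lte_fin => egh; exists g, h.
have [g [h [Sg Vg Sh Vh egh]]] := hf V oV Vf.
have ub : ((dual_norm (fun x => (g : dual E) x - (h : dual E) x))%:E
    <= diam ((S : set (dual E)) `&` V))%E.
  by apply: ereal_sup_ubound; exists (g, h).
by apply: lt_le_trans ub; rewrite lte_fin.
Qed.

Lemma szlenk_iterE (e : R) (S : set (dual E)) (a : Ord) :
  szlenk_iter e S a = derived (far e) (S : set (weak_star_topology E)) a.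
Proof.
elim: a => [|a IH|J i0 u IH] //=; first by rewrite szlenk_derivationE IH.
by apply/seteqP; split => f /= hf i; have := hf i; rewrite IH.
Qed.

Lemma dual_eval_inj : injective (@dual_eval _ E).
Proof. by move=> f g fg; apply: operator_ext => x; exact: (congr1 (fun h : E -> K => h x) fg). Qed.

Lemma weak_star_hausdorff : hausdorff_space (weak_star_topology E).
Proof.
move=> f g fg; apply: dual_eval_inj.
apply: (@hausdorff_product E (fun=> K^o) (fun=> @norm_hausdorff K K^o)).
move=> A B nA nB.
have [h [Ah Bh]] := fg (@dual_eval _ E @^-1` A) (@dual_eval _ E @^-1` B)
  (@initial_continuous _ _ _ f A nA) (@initial_continuous _ _ _ g B nB).
by exists (dual_eval h).
Qed.

Lemma continuous_weak_star (X : topologicalType) (f : X -> weak_star_topology E) :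
  (forall x, continuous (fun t => (f t : dual E) x : K^o)) -> continuous f.
Proof.
move=> cf t A [_ [[B oB <-] Bft BA]].
have ce : continuous (fun t => dual_eval (f t)).
  move=> s; apply/(@pointwise_cvgP E K^o) => x; exact: cf.
suff : nbhs t ((fun t => dual_eval (f t)) @^-1` B).
  by apply: filterS => s; exact: BA.
by apply: ce; exact: open_nbhs_nbhs.
Qed.

Lemma compact_weak_star (S : set (dual E)) :
  compact (@dual_eval _ E @` S) -> compact (S : set (weak_star_topology E)).
Proof.
move=> cS F FF FS.
have pre A : F A -> F (@dual_eval _ E @^-1` (@dual_eval _ E @` A)).
  by apply: filterS => f Af; exists f.
have [_ [[f Sf <-] hf]] := cS (@dual_eval _ E @ F) _ (pre S FS).
exists f; split=> // A B FA [_ [[C oC <-] Cf CB]].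
have [_ [[g Ag <-] Cg]] := hf (@dual_eval _ E @` A) C (pre A FA)
  (open_nbhs_nbhs (conj oC Cf)).
by exists g; split => //; exact: CB.
Qed.

(** Banach-Alaoglu: under evaluation the ball becomes the part of a product of scalar balls cut out
    by the linearity equations, each closed because it involves three coordinates. *)
Lemma compact_dual_ball :
  compact (@dual_ball R k E : set (weak_star_topology E)).
Proof.
apply: compact_weak_star.
pose L := [set m : {ptws E -> K^o} | forall aa : K * (E * E),
  m (aa.1 *: aa.2.1 + aa.2.2) = aa.1 * m aa.2.1 + m aa.2.2].
have cL : closed L.
  apply: closed_forall => -[a [x y]] /=; apply: closed_eq_continuous.
    exact: continuous_ptws_eval.
  apply: (continuous_scalarD (f := fun m : {ptws E -> K^o} => a * m x : K^o)).
    exact/continuous_scalarM/continuous_ptws_eval.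
  exact: continuous_ptws_eval.
rewrite (_ : image _ _ = [set m | forall x, modulus (m x) <= modulus x] `&` L).
  apply: subclosed_compact (@compact_box R k E (@modulus R k E)) _ => //.
  apply: closedI cL; apply: closed_forall => x.
  by apply/closed_le_continuous/continuous_modulus_comp/continuous_ptws_eval.
apply/seteqP; split=> [_ [f /dual_ballP f1 <-]|m [m1 mL]].
  by split=> // -[a [x y]] /=; rewrite /dual_eval linearP.
have [||f hf] := @operator_exists R k E K^o m 1.
- by move=> a x y; exact: (mL (a, (x, y))).
- by move=> x; rewrite mul1r; exact: m1.
exists f; last exact/funext.
by apply/dual_ballP => x; rewrite hf.
Qed.

End Dual.

Lemma compact_adjoint_image (R : realType) (k : scalar_kind)
    (E F : normedModType (scalars R k)) (T : operator E F) :
  compact (adjoint T @` @dual_ball R k F : set (weak_star_topology E)).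
Proof.
apply: (@continuous_compact (weak_star_topology F) (weak_star_topology E) (adjoint T));
  last exact: compact_dual_ball.
apply: continuous_subspaceT; apply: continuous_weak_star => x f A nA.
exact: (@initial_continuous _ _ (@dual_eval _ F) f _ (@continuous_ptws_eval F (scalars R k)^o (T x) (dual_eval f) A nA)).
Qed.

Lemma ler_addgt0_scaled (R : realType) (a b c : R) :
  (forall e, 0 < e -> a <= b + c * e) -> a <= b.
Proof.
move=> h; apply/ler_addgt0Pr => e e0.
(* The sign of [c] is unknown; adding 1 also covers [c = 0]. *)
have c0 : 0 < `|c| + 1 by rewrite ltr_wpDl.
apply: le_trans (h (e / (`|c| + 1)) _) _; first exact: divr_gt0.
rewrite lerD2l mulrCA; apply: ler_piMr; first exact: ltW.
rewrite ler_pdivrMr// mul1r.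
by rewrite (le_trans (ler_norm c))// lerDl.
Qed.

(** * Extension of an operator along a map with dense range *)

Section OperatorExtension.
Context {R : realType} {k : scalar_kind}.
Local Notation K := (scalars R k).
Context {E G : normedModType K} {F : completeNormedModType K}.
Variables (A : operator E G) (T : operator E F) (c : R).
Hypotheses (c0 : 0 <= c)
  (dense_range : forall g (e : R), 0 < e -> exists x, modulus (g - A x) <= e)
  (TA : forall x, modulus (T x) <= c * modulus (A x)).

(** The expected estimate |B g - T x| <= c |g - A x| taken as the definition of y = B g. It
    determines [y] and is compatible with linear combinations, so after the existence proof no limit
    has to be handled, and injectivity of [A] never comes up. *)
Let limit_at (g : G) (y : F) :=
  forall x, modulus (y - T x) <= c * modulus (g - A x).

Let limit_at_exists (g : G) : exists y, limit_at g y.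
Proof.
pose H : set_system F := [set P | exists2 e : R, 0 < e &
  forall x, modulus (g - A x) <= e -> P (T x)].
have HF : ProperFilter H.
  split; last split.
  - by move=> [e e0 h]; have [x /h] := dense_range g e0.
  - by exists 1.
  - move=> P Q [e e0 he] [d d0 hd]; exists (Num.min e d).
      by rewrite lt_min e0.
    by move=> x; rewrite le_min => /andP[? ?]; split; [apply: he|apply: hd].
  - by move=> P Q PQ [e e0 h]; exists e => // x /h/PQ.
have H_close (x : E) (e : R) : 0 < e ->
    H [set y | modulus (y - T x) <= c * (modulus (g - A x) + e)].
  move=> e0; exists e => // z hz; rewrite /= -linearB (le_trans (TA _))// ler_wpM2l//.
  rewrite linearB -(subrKA g) (le_trans (ler_modulusD _ _))// addrC lerD//.
  by rewrite modulus_distC.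
have cH : cauchy H.
  apply/cauchy_modulusP => e e0.
  (* If [A x] and [A z] are both [d]-close to [g], then [T x] and [T z] are [2 c d]-close; the extra
     1 keeps the quotient meaningful for [c = 0] and makes the inequality strict. *)
  have p : 0 < 2 * c + 1 by rewrite ltr_wpDl// mulr_ge0.
  have d0 : 0 < e / (2 * c + 1) by rewrite divr_gt0.
  have [x hx] := dense_range g d0.
  exists (T x); apply: filterS (H_close x _ d0) => y /= hy.
  apply: le_lt_trans hy _; apply: (@le_lt_trans _ _ (2 * c * (e / (2 * c + 1)))).
    by rewrite -mulrA mulrCA ler_wpM2l// [leRHS]mulr_natl mulr2n lerD.
  by rewrite mulrA ltr_pdivrMr// mulrC ltr_pM2l// ltrDl.
have /cvg_ex[y Hy] : cvg H by exact: cauchy_cvg.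
exists y => x; apply: (@ler_addgt0_scaled _ _ _ (1 + c)) => e e0.
have [y' [/= h1 h2]] := filter_ex (filterI ((cvg_modulusP y).1 Hy e e0) (H_close x e e0)).
rewrite -(subrKA y') (le_trans (ler_modulusD _ _))// modulus_distC.
by rewrite (le_trans (lerD (ltW h1) h2))// mulrDr mulrDl mul1r addrCA.
Qed.

Let limit_at_unique (g : G) (y y' : F) : limit_at g y -> limit_at g y' -> y = y'.
Proof.
move=> hy hy'; apply/eqP; rewrite -subr_eq0; apply/eqP/modulus_eq0/le_anti.
rewrite modulus_ge0 andbT; apply: (@ler_addgt0_scaled _ _ _ (c + c)) => e e0.
have [x hx] := dense_range g e0; rewrite add0r -(subrKA (T x)).
rewrite (le_trans (ler_modulusD _ _))// mulrDl lerD//.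
  by apply: le_trans (hy x) _; rewrite ler_wpM2l.
by rewrite modulus_distC; apply: le_trans (hy' x) _; rewrite ler_wpM2l.
Qed.

Let limit_at_linear (a : K) (g g' : G) (y y' : F) :
  limit_at g y -> limit_at g' y' -> limit_at (a *: g + g') (a *: y + y').
Proof.
move=> hy hy' x; apply: (@ler_addgt0_scaled _ _ _ (c * (modulus a + 1) *+ 2)).
move=> e e0; have [u hu] := dense_range g e0; have [v hv] := dense_range g' e0.
have eT : a *: (y - T u) + (y' - T v) = a *: y + y' - T (a *: u + v).
  by rewrite linearP scalerBr addrACA -opprD.
have eA : a *: (g - A u) + (g' - A v) = a *: g + g' - A (a *: u + v).
  by rewrite linearP scalerBr addrACA -opprD.
(* Pass through [T (a *: u + v)]; each of the two summands costs [c * (modulus a + 1) * e], whence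
   the factor 2 above. *)
have -> : a *: y + y' - T x =
    (a *: (y - T u) + (y' - T v)) + T (a *: u + v - x).
  by rewrite eT (linearB T) subrKA.
have hA : modulus (A (a *: u + v - x)) <=
    modulus (a *: g + g' - A x) + (modulus a + 1) * e.
  have -> : A (a *: u + v - x) =
      (a *: g + g' - A x) - (a *: (g - A u) + (g' - A v)).
    by rewrite eA opprB [RHS]addrC subrKA (linearB A).
  rewrite (le_trans (ler_modulusB _ _))// lerD2l (le_trans (ler_modulusD _ _))//.
  by rewrite mulrDl mul1r lerD// modulusZ ler_wpM2l ?modulus_ge0.
have h1 : modulus (a *: (y - T u) + (y' - T v)) <= c * (modulus a + 1) * e.
  rewrite (le_trans (ler_modulusD _ _))// modulusZ mulrDr mulr1 mulrDl lerD//.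
    rewrite [c * _]mulrC -mulrA ler_wpM2l ?modulus_ge0// (le_trans (hy u))//.
    by rewrite ler_wpM2l.
  by rewrite (le_trans (hy' v))// ler_wpM2l.
have h2 : modulus (T (a *: u + v - x)) <=
    c * modulus (a *: g + g' - A x) + c * (modulus a + 1) * e.
  by apply: le_trans (TA _) _; rewrite -mulrA -mulrDr ler_wpM2l.
rewrite (le_trans (ler_modulusD _ _))// (le_trans (lerD h1 h2))//.
by rewrite mulr2n mulrDl addrCA.
Qed.

Lemma operator_extension : exists B : operator G F, forall x, B (A x) = T x.
Proof.
pose f g := projT1 (cid (limit_at_exists g)).
have hf g : limit_at g (f g) by exact: (projT2 (cid (limit_at_exists g))).
have [|g|B hB] := @operator_exists R k G F f c.
- by move=> a g g'; apply: limit_at_unique (hf _) (limit_at_linear _ _ _).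
- by have := hf g 0; rewrite (linear0 T) (linear0 A) !subr0.
exists B => x; rewrite hB; apply/eqP; rewrite -subr_eq0; apply/eqP/modulus_eq0/le_anti.
by rewrite modulus_ge0 andbT; apply: le_trans (hf _ x) _; rewrite subrr modulus0 mulr0.
Qed.

End OperatorExtension.

(** * Completion for a family of functionals *)

Section Completion.
Context {R : realType} {k : scalar_kind}.
Local Notation K := (scalars R k).

(** The index set carries a topology because points will be found by compactness; [family_point]
    keeps the suprema over nonempty sets. *)
Record functional_family (E : normedModType K) := FunctionalFamily {
  family_index : topologicalType;
  family_point : family_index;
  functional :> family_index -> E -> K^o;
  functional_linear : forall i, linear (functional i);
  functional_le : forall i x, modulus (functional i x) <= modulus x
}.

Context {E : normedModType K}.
Implicit Type l : functional_family E.

(* The completion of [E] for the seminorm [sup_i |l_i x|], realised as the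
   uniform closure of the functions [i |-> l_i x]. *)
Record completion l := Completion {
  completion_fun :> family_index l -> K^o;
  completion_approx : forall e : R, 0 < e ->
    exists x, forall i, modulus (completion_fun i - l i x) <= e
}.

Lemma completion_ext l (u v : completion l) : u =1 v -> u = v.
Proof.
case: u v => [u hu] [v hv] /= /funext uv; move: hu; rewrite uv => hu.
by congr Completion; exact: Prop_irrelevance.
Qed.

HB.instance Definition _ l := gen_eqMixin (completion l).
HB.instance Definition _ l := gen_choiceMixin (completion l).

Section Module.
Variable l : functional_family E.
Local Notation G := (completion l).

Lemma completion_of_approx (x : E) (e : R) : 0 < e ->
  exists y, forall i, modulus (l i x - l i y) <= e.
Proof. by move=> e0; exists x => i; rewrite subrr modulus0 ltW. Qed.

Definition to_completion (x : E) : G := Completion (completion_of_approx x).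

Lemma completion_lin_approx (a : K) (u v : G) (e : R) : 0 < e ->
  exists x, forall i, modulus (a * u i + v i - l i x) <= e.
Proof.
move=> e0; have c0 : 0 < modulus a + 1 by rewrite ltr_wpDl// modulus_ge0.
have d0 : 0 < e / (modulus a + 1) by exact: divr_gt0.
have [x hx] := completion_approx u d0; have [y hy] := completion_approx v d0.
exists (a *: x + y) => i; rewrite functional_linear.
have -> : a * u i + v i - (a *: l i x + l i y) = a * (u i - l i x) + (v i - l i y).
  by rewrite opprD addrACA -mulrBr.
rewrite (le_trans (ler_modulusD _ _))// modulusM.
have <- : modulus a * (e / (modulus a + 1)) + e / (modulus a + 1) = e.
  by rewrite -[X in _ + X]mul1r -mulrDl mulrCA mulfV ?gt_eqF// mulr1.
by rewrite lerD// ler_wpM2l ?modulus_ge0.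
Qed.

(** Sum, opposite and scalar multiple are all instances of this one operation, so that a single
    approximation argument serves for all three. *)
Definition completion_lin (a : K) (u v : G) : G :=
  Completion (completion_lin_approx a u v).

Let zero : G := to_completion 0.
Let add (u v : G) := completion_lin 1 u v.
Let opp (u : G) := completion_lin (-1) u zero.
Let scale (a : K) (u : G) := completion_lin a u zero.

Let zeroE i : zero i = 0.
Proof.
have := functional_linear (f := l) i 1 0 0.
by rewrite scaler0 addr0 scale1r => /eqP; rewrite -subr_eq0 opprD addNKr oppr_eq0 => /eqP.
Qed.

Let addA : associative add.
Proof. by move=> u v w; apply: completion_ext => i /=; rewrite !mul1r addrA. Qed.
Let addC : commutative add.
Proof. by move=> u v; apply: completion_ext => i /=; rewrite !mul1r addrC. Qed.
Let add0 : left_id zero add.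
Proof. by move=> u; apply: completion_ext => i /=; rewrite mul1r [l i 0]zeroE add0r. Qed.
Let addN : left_inverse zero opp add.
Proof.
move=> u; apply: completion_ext => i /=.
by rewrite mul1r [l i 0]zeroE mulN1r addr0 addNr.
Qed.

HB.instance Definition _ := GRing.isZmodule.Build G addA addC add0 addN.

Let scaleA (a b : K) (v : G) : scale a (scale b v) = scale (a * b) v.
Proof. by apply: completion_ext => i /=; rewrite [l i 0]zeroE !addr0 mulrA. Qed.
Let scale1 : left_id 1 scale.
Proof. by move=> u; apply: completion_ext => i /=; rewrite [l i 0]zeroE addr0 mul1r. Qed.
Let scaleDr : right_distributive scale +%R.
Proof.
by move=> a u v; apply: completion_ext => i /=; rewrite [l i 0]zeroE !addr0 !mul1r mulrDr.
Qed.
Let scaleDl (v : G) : {morph scale^~ v : a b / a + b}.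
Proof.
by move=> a b; apply: completion_ext => i /=; rewrite [l i 0]zeroE !addr0 mul1r mulrDl.
Qed.

HB.instance Definition _ :=
  GRing.Zmodule_isLmodule.Build K G scaleA scale1 scaleDr scaleDl.

Lemma completion_linE (a : K) (u v : G) i : (a *: u + v) i = a * u i + v i.
Proof. by rewrite [LHS]/= [l i 0]zeroE addr0 mul1r. Qed.

Lemma completionD (u v : G) i : (u + v) i = u i + v i.
Proof. by rewrite [LHS]/= mul1r. Qed.

Lemma completionZ (a : K) (u : G) i : (a *: u) i = a * u i.
Proof. by rewrite [LHS]/= [l i 0]zeroE addr0. Qed.

Lemma completionB (u v : G) i : (u - v) i = u i - v i.
Proof. by rewrite completionD -scaleN1r completionZ mulN1r. Qed.

Definition sup_norm (u : G) : R := sup [set modulus (u i) | i in setT].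

Lemma completion_bounded (u : G) : exists c : R, forall i, modulus (u i) <= c.
Proof.
have [x hx] := completion_approx u ltr01; exists (1 + modulus x) => i.
rewrite -(subrK (l i x) (u i)) (le_trans (ler_modulusD _ _))// lerD//.
exact: functional_le.
Qed.

Lemma le_sup_norm (u : G) i : modulus (u i) <= sup_norm u.
Proof.
have [c hc] := completion_bounded u; apply: ub_le_sup; last by exists i.
by exists c => _ [j _ <-].
Qed.

Lemma sup_norm_le (u : G) (c : R) : (forall i, modulus (u i) <= c) -> sup_norm u <= c.
Proof.
by move=> h; apply: ge_sup; [exists (modulus (u (family_point l))), (family_point l)|move=> _ [i _ <-]].
Qed.

Lemma sup_norm_ge0 (u : G) : 0 <= sup_norm u.
Proof. by apply: le_trans (le_sup_norm u (family_point l)); exact: modulus_ge0. Qed.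

Let nrm (u : G) : K := of_real (sup_norm u).

Let nrmD (u v : G) : nrm (u + v) <= nrm u + nrm v.
Proof.
rewrite /nrm -of_realD le_of_real; apply: sup_norm_le => i.
by rewrite completionD (le_trans (ler_modulusD _ _))// lerD// le_sup_norm.
Qed.

Let nrmZ (a : K) (u : G) : nrm (a *: u) = `|a| * nrm u.
Proof.
rewrite /nrm normE -of_realM; congr of_real.
have le (b : K) v : sup_norm (b *: v) <= modulus b * sup_norm v.
  apply: sup_norm_le => i; rewrite completionZ modulusM.
  by rewrite ler_wpM2l ?modulus_ge0// le_sup_norm.
apply/le_anti; rewrite le /=; have [->|a0] := eqVneq a 0.
  by rewrite modulus0 mul0r sup_norm_ge0.
have ma : 0 < modulus a.
  by rewrite lt_neqAle modulus_ge0 andbT eq_sym; apply: contra_neq a0 => /modulus_eq0.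
(* The reverse inequality is [le] for the inverse of [a], applied to [a *: u]. *)
rewrite mulrC -ler_pdivlMr// mulrC -[u in X in X <= _](scalerK a0).
apply: le_trans (le _ _) _; rewrite ler_wpM2r ?sup_norm_ge0//.
have : modulus a^-1 * modulus a = 1 by rewrite -modulusM mulVf// modulus1.
by move/(canRL (mulfK (lt0r_neq0 ma))) ->; rewrite mul1r.
Qed.

Let nrm_eq0 (u : G) : nrm u = 0 -> u = 0.
Proof.
move=> /(congr1 (@real_value R k)); rewrite real_valueK raddf0 => u0.
apply: completion_ext => i; rewrite [RHS]zeroE; apply/modulus_eq0/le_anti.
by rewrite modulus_ge0 -u0 le_sup_norm.
Qed.

HB.instance Definition _ := Lmodule_isNormed.Build K G nrmD nrmZ nrm_eq0.

Lemma modulus_completion (u : G) : modulus u = sup_norm u.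
Proof. by rewrite /modulus real_valueK. Qed.

End Module.
End Completion.

Section CompletionTheory.
Context {R : realType} {k : scalar_kind}.
Local Notation K := (scalars R k).
Context {E : normedModType K} (l : functional_family E).
Local Notation G := (completion l).

Lemma le_modulus_completion (u : G) i : modulus (u i) <= modulus u.
Proof. by rewrite modulus_completion le_sup_norm. Qed.

Lemma modulus_completion_le (u : G) (c : R) :
  (forall i, modulus (u i) <= c) -> modulus u <= c.
Proof. by rewrite modulus_completion; exact: sup_norm_le. Qed.

(** Coordinatewise limits exist by completeness of the scalars; the Cauchy property makes the
    convergence uniform, and a uniform limit is still uniformly approximable by vectors of [E]. *)
Lemma completion_cauchy_cvg (H : set_system G) :
  ProperFilter H -> cauchy H -> cvg H.
Proof.
move=> HF /cauchy_modulusP cH.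
have lim_at i : exists a : K^o, (fun u : G => u i : K^o) @ H --> a.
  apply/cvg_ex; apply: scalar_complete; apply/cauchy_modulusP => e e0.
  have [u hu] := cH e e0; exists (u i).
  have : H [set v : G | modulus (v i - u i) < e].
    apply: filterS hu => v /=; apply: le_lt_trans.
    by rewrite -completionB le_modulus_completion.
  by [].
pose a i := projT1 (cid (lim_at i)).
have ha i : (fun u : G => u i : K^o) @ H --> a i by exact: (projT2 (cid (lim_at i))).
have close (u : G) (e : R) : H [set v | modulus (v - u) < e] ->
    forall i, modulus (u i - a i) <= e.
  move=> hu i; apply: (@ler_addgt0_scaled _ _ _ 1) => d d0.
  have hd : H [set v : G | modulus (v i - a i) < d].
    exact: ((cvg_modulusP (a i)).1 (ha i) d d0).
  have [v [/= h1 h2]] := filter_ex (filterI hu hd).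
  rewrite -(subrKA (v i)) (le_trans (ler_modulusD _ _))// mul1r lerD//; last exact: ltW.
  by rewrite modulus_distC -completionB (le_trans (le_modulus_completion _ _))// ltW.
have approx (e : R) : 0 < e -> exists x, forall i, modulus (a i - l i x) <= e.
  move=> e0; have e20 : 0 < e / 2 by exact: divr_gt0.
  have [u /close hu] := cH _ e20; have [x hx] := completion_approx u e20.
  exists x => i; rewrite -(subrKA (u i)) (le_trans (ler_modulusD _ _))//.
  by rewrite (splitr e) lerD// modulus_distC.
apply/cvg_ex; exists (Completion approx); apply/cvg_modulusP => e e0.
have e30 : 0 < e / 3 by exact: divr_gt0.
have [u hu] := cH _ e30; apply: filterS (hu) => v /= uv.
apply: (@le_lt_trans _ _ (e / 3 + e / 3)); last by lra.
apply: modulus_completion_le => i; rewrite completionB /=.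
rewrite -(subrKA (u i)) (le_trans (ler_modulusD _ _))// lerD//; last exact: close.
by rewrite -completionB (le_trans (le_modulus_completion _ _))// ltW.
Qed.

HB.instance Definition _ := Uniform_isComplete.Build G completion_cauchy_cvg.

Lemma to_completion_operator_exists :
  exists A : operator E G, forall x, A x = to_completion l x.
Proof.
apply: (@operator_exists R k E G _ 1) => [a x y|x].
  by apply: completion_ext => i; rewrite completion_linE /= functional_linear.
by apply: modulus_completion_le => i; rewrite mul1r functional_le.
Qed.

Definition completion_map : operator E G := projT1 (cid to_completion_operator_exists).

Lemma completion_mapE x i : completion_map x i = l i x.
Proof. by rewrite /completion_map (projT2 (cid to_completion_operator_exists)). Qed.

Lemma completion_map_dense (u : G) (e : R) : 0 < e ->
  exists x, modulus (u - completion_map x) <= e.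
Proof.
move=> e0; have [x hx] := completion_approx u e0; exists x.
by apply: modulus_completion_le => i; rewrite completionB completion_mapE.
Qed.

Lemma functional_comb (i j i' : family_index l) (a b : K) :
  (forall x, l i' x = a * l i x + b * l j x) ->
  forall u : G, u i' = a * u i + b * u j.
Proof.
move=> h u; apply/eqP; rewrite -subr_eq0; apply/eqP/modulus_eq0/le_anti.
rewrite modulus_ge0 andbT.
apply: (@ler_addgt0_scaled _ _ _ (1 + (modulus a + modulus b))) => e e0.
have [x hx] := completion_approx u e0.
have -> : u i' - (a * u i + b * u j) =
    (u i' - l i' x) - (a * (u i - l i x) + b * (u j - l j x)).
  by rewrite h !mulrBr addrACA -opprD opprB subrKA.
rewrite add0r (le_trans (ler_modulusB _ _))// mulrDl mul1r lerD//.
rewrite (le_trans (ler_modulusD _ _))// !modulusM mulrDl lerD// ler_wpM2l ?modulus_ge0//.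
Qed.

(** Distances between point functionals can be tested on vectors of [E] in the unit ball of the
    seminorm. The approximant [x] of [u] is normalised by [modulus u + e], which is positive even
    for [u = 0]. *)
Lemma functional_dist (i j : family_index l) (c : R) : 0 <= c ->
  (forall x, (forall m, modulus (l m x) <= 1) -> modulus (l i x - l j x) <= c) ->
  forall u : G, modulus (u i - u j) <= c * modulus u.
Proof.
move=> c0 h u.
apply: (@ler_addgt0_scaled _ _ _ (c + 2)) => e e0.
have [x hx] := completion_approx u e0.
have s0 : 0 < modulus u + e by rewrite ltr_wpDl ?modulus_ge0.
have lZ m (r : K) : l m (r *: x) = r * l m x.
  by rewrite -!completion_mapE linearZ completionZ.
have hij : modulus (l i x - l j x) <= c * (modulus u + e).
  have := h (of_real (modulus u + e)^-1 *: x).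
  rewrite !lZ -mulrBr modulusM modulus_of_real gtr0_norm ?invr_gt0//.
  rewrite ler_pdivrMl// mulrC; apply => m.
  rewrite lZ modulusM modulus_of_real gtr0_norm ?invr_gt0//.
  rewrite ler_pdivrMl// mulr1 -(subrK (u m) (l m x)) (le_trans (ler_modulusD _ _))//.
  by rewrite addrC lerD ?le_modulus_completion// modulus_distC.
have -> : u i - u j = (u i - l i x) + (l i x - l j x) - (u j - l j x).
  by rewrite subrKA opprB subrKA.
rewrite (le_trans (ler_modulusB _ _))//.
apply: le_trans (lerD (ler_modulusD _ _) (lexx _)) _.
apply: le_trans (lerD (lerD (hx i) hij) (hx j)) _.
lra.
Qed.

Lemma completion_continuous (u : G) :
  (forall x, continuous (fun i => l i x)) -> continuous (completion_fun u).
Proof.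
move=> cl i; apply/cvg_modulusP => e e0.
have e30 : 0 < e / 3 by exact: divr_gt0.
have [x hx] := completion_approx u e30.
have : nbhs i [set j | modulus (l j x - l i x) < e / 3].
  by have /cvg_modulusP/(_ _ e30) := cl x i.
suff sub : [set j | modulus (l j x - l i x) < e / 3] `<=`
    [set j | modulus (u j - u i) < e] by exact: filterS sub.
move=> j /= hj.
have -> : u j - u i = (u j - l j x) + (l j x - l i x) - (u i - l i x).
  by rewrite subrKA opprB subrKA.
rewrite (le_lt_trans (ler_modulusB _ _))//.
apply: le_lt_trans (lerD (ler_modulusD _ _) (lexx _)) _.
by move: (hx i) (hx j) hj; lra.
Qed.

Lemma point_functional_exists (i : family_index l) :
  exists f : dual G, forall u, f u = u i.
Proof.
apply: (@operator_exists R k G K^o (fun u : G => u i) 1) => [a u v|u].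
  exact: completion_linE.
by rewrite mul1r le_modulus_completion.
Qed.

Definition point_functional (i : family_index l) : dual G :=
  projT1 (cid (point_functional_exists i)).

Lemma point_functionalE i u : point_functional i u = u i.
Proof. exact: (projT2 (cid (point_functional_exists i))). Qed.

End CompletionTheory.

(** * Functionals of norm at most 1 on the completion are evaluations at points *)

Section DualBallOfCompletion.
Context {R : realType} {k : scalar_kind}.
Local Notation K := (scalars R k).
Context {E : normedModType K} (l : functional_family E).
Local Notation G := (completion l).
Hypotheses
  (compact_index : compact [set: family_index l])
  (continuous_functional : forall x, continuous (fun i => l i x))
  (absolutely_convex : forall i j (a b : K), modulus a + modulus b <= 1 ->
     exists m, forall x, l m x = a * l i x + b * l j x).

Let completion_sumE n (a : nat -> K) (w : nat -> G) i :
  (\sum_(j < n) a j *: w j : G) i = \sum_(j < n) a j * w j i.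
Proof.
rewrite -point_functionalE linear_sum; apply: eq_bigr => j _.
by rewrite linearZ /= point_functionalE.
Qed.

(* The point [i0] of the family closest to [g] in the coordinates [w j]
   maximises [Re psi], [psi] being the conjugate of the error; hence
   [Re (g psi) <= |psi| <= Re (psi i0)], which says that the error vanishes. *)
Lemma dual_ball_finite_point (g : dual G) (n : nat) (w : nat -> G) :
  dual_ball g -> exists i, forall j, (j < n)%N -> g (w j) = w j i.
Proof.
move=> /dual_ballP g1.
pose dev i := \sum_(j < n) modulus (g (w j) - w j i) ^+ 2.
have cdev : continuous dev.
  have cmod j : continuous (fun i => modulus (g (w j) - w j i)).
    apply: (continuous_modulus_comp (f := fun i => g (w j) - w j i : K^o)).
    apply: continuous_scalarB; first by move=> i; exact: cvg_cst.
    exact: completion_continuous.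
  apply: (continuous_real_sum (f := fun j i => modulus (g (w j) - w j i) ^+ 2)).
  by move=> j i; exact: (cvgM (cmod j i) (cmod j i)).
have [i0 _ hmin] := compact_EVT_min (ex_intro _ (family_point l) I) compact_index
  (continuous_subspaceT cdev).
pose z j : K := g (w j) - w j i0.
pose psi : G := \sum_(j < n) scalar_conj (z j) *: w j.
have psiE i : psi i = \sum_(j < n) scalar_conj (z j) * w j i.
  exact: completion_sumE (fun j => scalar_conj (z j)) w i.
(* First-order condition at the minimum: moving from [i0] towards [m] by a step [t] changes [dev] by
   -2 t (Re psi m - Re psi i0) + t^2 C, which cannot be negative; then let [t] go to 0. The cap
   [t <= 1] keeps the combination convex. *)
have psi_max m : real_value (psi m) <= real_value (psi i0).
  pose C := \sum_(j < n) modulus (w j m - w j i0) ^+ 2.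
  apply: (@ler_addgt0_scaled _ _ _ C) => e e0.
  pose t := Num.min 1 e.
  have t0 : 0 < t by rewrite lt_min ltr01.
  have t1 : t <= 1 by rewrite ge_min lexx.
  have te : t <= e by rewrite ge_min lexx orbT.
  have C0 : 0 <= C by apply: sumr_ge0 => j _; rewrite sqr_ge0.
  have [|mt hmt] := @absolutely_convex i0 m (of_real (1 - t)) (of_real t).
    by rewrite !modulus_of_real_ge0 ?subr_ge0 ?subrK// ltW.
  have devE : dev mt = dev i0 - 2 * t * (real_value (psi m) - real_value (psi i0))
      + t ^+ 2 * C.
    rewrite /dev !psiE -raddfB -sumrB raddf_sum !mulr_sumr -sumrN -!big_split /=.
    apply: eq_bigr => j _; rewrite (functional_comb hmt).
    have -> : g (w j) - (of_real (1 - t) * w j i0 + of_real t * w j m) =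
        z j + of_real (- t) * (w j m - w j i0).
      rewrite /z (rmorphB of_real) /= of_real1 (rmorphN of_real) /=; ring.
    rewrite modulus_squareD modulusM modulus_of_real normrN (ger0_norm (ltW t0)).
    rewrite mulrCA real_valueZ -mulrBr; ring.
  have := hmin mt; rewrite in_setT => /(_ isT); rewrite devE => h.
  have h2 : 2 * t * (real_value (psi m) - real_value (psi i0)) <= t * (t * C) by lra.
  have : 2 * (real_value (psi m) - real_value (psi i0)) <= t * C.
    by rewrite -(ler_pM2l t0) (le_trans _ h2)// mulrA [t * 2]mulrC.
  have : t * C <= C * e by rewrite mulrC ler_wpM2l.
  have : 0 <= C * e by rewrite mulr_ge0// ltW.
  lra.
(* The family is balanced, so a phase turns |psi m| into the real part of [psi] at another point. *)
have psi_norm : modulus psi <= real_value (psi i0).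
  apply: modulus_completion_le => m.
  have [c [c1 hc]] := scalar_phase (psi m).
  have [|m' hm'] := @absolutely_convex m m c 0; first by rewrite modulus0 addr0.
  have := psi_max m'; rewrite (functional_comb hm') mul0r addr0 hc.
  by rewrite real_valueK.
have : real_value (g psi - psi i0) <= 0.
  rewrite raddfB subr_le0 (le_trans (ler_norm _))// (le_trans (norm_real_value _))//.
  exact: le_trans (g1 psi) psi_norm.
have gpsi : g psi = \sum_(j < n) scalar_conj (z j) * g (w j).
  by rewrite linear_sum; apply: eq_bigr => j _; rewrite linearZ.
rewrite gpsi psiE -sumrB raddf_sum => hsum; exists i0 => j jn.
apply/eqP; rewrite -subr_eq0; apply/eqP/modulus_eq0/eqP; rewrite -sqrf_eq0.
(* Thus the real part of [g psi - psi i0], already known to be at most 0, is the sum of the squared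
   errors. *)
have hterm (j' : 'I_n) :
    real_value (scalar_conj (z j') * g (w j') - scalar_conj (z j') * w j' i0) =
    modulus (z j') ^+ 2.
  by rewrite -mulrBr -modulus_conj_square real_valueK.
have : \sum_(j' < n) modulus (z j') ^+ 2 == 0.
  have sum_ge0 : 0 <= \sum_(j' < n) modulus (z j') ^+ 2.
    by apply: sumr_ge0 => j' _; exact: sqr_ge0.
  rewrite eq_le sum_ge0 andbT (le_trans _ hsum)// le_eqVlt; apply/orP; left.
  by apply/eqP/eq_bigr => j' _; exact: esym (hterm j').
rewrite psumr_eq0 => [/allP/(_ (Ordinal jn))|j' _]; last exact: sqr_ge0.
by rewrite mem_index_enum => /(_ isT).
Qed.

(** The sets of points that agree with [g] on finitely many vectors are nonempty by the previous
    lemma; a cluster point of the filter they generate agrees with [g] everywhere. *)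
Lemma dual_ball_point (g : dual G) :
  dual_ball g -> exists i, g = point_functional i.
Proof.
move=> g1; pose agree (s : seq G) := [set i | forall u, u \in s -> g u = u i].
pose H : set_system (family_index l) := [set P | exists s, agree s `<=` P].
have HF : ProperFilter H.
  split; last split.
  - move=> [s hs]; have [i hi] := @dual_ball_finite_point g (size s) (nth 0 s) g1.
    apply: (hs i) => u us; rewrite -(nth_index 0 us); apply: hi.
    by rewrite index_mem.
  - by exists [::].
  - move=> P Q [s hs] [t ht]; exists (s ++ t) => i hi; split.
      by apply: hs => u us; apply: hi; rewrite mem_cat us.
    by apply: ht => u ut; apply: hi; rewrite mem_cat ut orbT.
  - by move=> P Q PQ [s hs]; exists s; exact: subset_trans PQ.
have [|i [_ hi]] := compact_index HF; first by exists [::].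
exists i; apply: operator_ext => u; rewrite point_functionalE.
have : closed [set j | g u = u j].
  apply: (closed_eq_continuous (f := fun=> g u)) => [j|]; first exact: cvg_cst.
  exact: completion_continuous.
apply=> A iA; have Hu : H (agree [:: u]) by exists [:: u].
have [j [hj Aj]] := hi _ _ Hu iA; exists j; split=> //=.
by apply: hj; rewrite inE.
Qed.

Lemma continuous_point_functional :
  continuous (point_functional (l := l) : family_index l -> weak_star_topology G).
Proof.
apply: continuous_weak_star => u.
under eq_fun do rewrite point_functionalE.
exact: completion_continuous.
Qed.

End DualBallOfCompletion.

(** * The Hahn-Banach theorem *)

Section HahnBanach.
Context {R : realType} {k : scalar_kind}.
Local Notation K := (scalars R k).
Context {F : normedModType K}.

(** Domination by the norm is built in: it bounds infima of such functionals from below. *)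
Definition sublinear (p : F -> R) : Prop :=
  [/\ forall x y, p (x + y) <= p x + p y,
      forall (r : R) x, 0 < r -> p (of_real r *: x) = r * p x &
      forall x, p x <= modulus x].

Lemma sublinear0 p : sublinear p -> p 0 = 0.
Proof.
by move=> [_ pZ _]; have := pZ 2 0 (ltr0Sn _ 1); rewrite scaler0 => h; lra.
Qed.

Lemma sublinear_modulus : sublinear (@modulus R k F).
Proof.
split=> // [x y|r x r0]; first exact: ler_modulusD.
by rewrite modulusZ modulus_of_real gtr0_norm.
Qed.

Lemma sublinear_geN p x : sublinear p -> - p (- x) <= p x.
Proof.
move=> sp; have [pD _ _] := sp; have := pD x (- x).
rewrite subrr sublinear0// => ?; lra.
Qed.

(** Common core of the two infima taken below, one over a real parameter and one over a chain; the
    conditions on [q] ask for directedness up to the algebraic operation. *)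
Lemma sublinear_inf (J : Type) (j0 : J) (q : J -> F -> R) (b : F -> R) :
  (forall j x, b x <= q j x) ->
  (forall i j x y, exists m, q m (x + y) <= q i x + q j y) ->
  (forall j (r : R) x, 0 < r -> exists m, q m (of_real r *: x) <= r * q j x) ->
  (forall x, q j0 x <= modulus x) ->
  exists2 p, sublinear p & forall j x, p x <= q j x.
Proof.
move=> bq qD qZ q1; pose p x := inf [set q j x | j in setT].
have hlb x : has_lbound [set q j x | j in setT].
  by exists (b x) => _ [j _ <-].
have pq j x : p x <= q j x by apply: ge_inf => //; exists j.
have le_p x c : (forall j, c <= q j x) -> c <= p x.
  by move=> h; apply: lb_le_inf; [exists (q j0 x), j0|move=> _ [j _ <-]].
have pZ (r : R) x : 0 < r -> p (of_real r *: x) <= r * p x.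
  move=> r0; rewrite -ler_pdivrMl//; apply: (le_p) => j.
  rewrite ler_pdivrMl//; have [m hm] := qZ j r x r0.
  exact: le_trans (pq m _) hm.
exists p => //; split.
- move=> x y; rewrite -lerBlDr; apply: (le_p) => i; rewrite lerBlDr -lerBlDl.
  apply: (le_p) => j; rewrite lerBlDl; have [m hm] := qD i j x y.
  exact: le_trans (pq m _) hm.
- move=> r x r0; apply/le_anti; rewrite pZ//= -ler_pdivlMl//.
  have -> : p x = p (of_real r^-1 *: (of_real r *: x)).
    by rewrite scalerA -of_realM mulVf ?gt_eqF// of_real1 scale1r.
  by rewrite pZ// invr_gt0.
- by move=> x; apply: le_trans (pq j0 x) (q1 x).
Qed.

(* [p'] is [x |-> inf_{t >= 0} p (x + t a) - t p a]: a minimal sublinear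
   functional is therefore odd, hence additive. *)
Lemma sublinear_reduce p (a : F) : sublinear p ->
  exists p', [/\ sublinear p', forall x, p' x <= p x & p' (- a) <= - p a].
Proof.
move=> sp; have [pD pZ p1] := sp; have p0 := sublinear0 sp.
have pZ0 (r : R) x : 0 <= r -> p (of_real r *: x) = r * p x.
  rewrite le_eqVlt => /predU1P[<-|]; last exact: pZ.
  by rewrite of_real0 scale0r p0 mul0r.
pose J := {t : R | 0 <= t}.
pose mkJ t (h : 0 <= t) : J := exist _ t h.
pose q (t : J) x := p (x + of_real (sval t) *: a) - sval t * p a.
have z0 : (0 : R) <= 0 by [].
have one0 : (0 : R) <= 1 by [].
have [t x|s t x y|t r x r0|x|p' sp' hp'] :=
    @sublinear_inf J (mkJ 0 z0) q (fun x => - p (- x)).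
- rewrite /q lerBrDr -pZ0; last exact: (svalP t).
  by have := pD (x + of_real (sval t) *: a) (- x); rewrite addrAC subrr add0r => ?; lra.
- have st0 : 0 <= sval s + sval t by rewrite addr_ge0// (svalP s, svalP t).
  exists (mkJ _ st0); rewrite /q /= of_realD scalerDl addrACA mulrDl.
  by have := pD (x + of_real (sval s) *: a) (y + of_real (sval t) *: a) => ?; lra.
- have rt0 : 0 <= r * sval t by apply: mulr_ge0; [exact: ltW|exact: (svalP t)].
  exists (mkJ _ rt0); rewrite /q /= of_realM -scalerA -scalerDr pZ//.
  by rewrite mulrBr mulrA.
- by rewrite /q /= of_real0 scale0r addr0 mul0r subr0.
exists p'; split=> // [x|].
  by apply: le_trans (hp' (mkJ 0 z0) x) _; rewrite /q /= of_real0 scale0r addr0 mul0r subr0.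
apply: le_trans (hp' (mkJ 1 one0) (- a)) _.
by rewrite /q /= of_real1 scale1r addNr p0 mul1r sub0r.
Qed.

Lemma sublinear_minimal p0 : sublinear p0 -> exists p, [/\ sublinear p,
  forall x, p x <= p0 x &
  forall q, sublinear q -> (forall x, q x <= p x) -> forall x, p x <= q x].
Proof.
move=> sp0; pose S := {p : F -> R | sublinear p /\ forall x, p x <= p0 x}.
pose rel_S (p q : S) := `[< forall x, sval q x <= sval p x >].
pose s0 : S := exist _ p0 (conj sp0 (fun x => lexx _)).
have [||A chainA|[p [sp pp0]] hp] := @ZL_preorder S s0 rel_S.
- by move=> p; apply/asboolP.
- by move=> p q r /asboolP pq /asboolP qr; apply/asboolP => x; apply: le_trans (qr x) (pq x).
- have [[s As]|/forallNP noA] := pselect (exists s, A s); last first.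
    by exists s0 => s /noA.
  pose J := {s | A s}.
  have [s' x|s' t x y|s' r x r0|x|p sp hp] :=
      @sublinear_inf J (exist _ s As) (fun s => sval (sval s)) (fun x => - modulus x).
  + have [st _] := svalP (sval s'); rewrite -[leRHS]opprK lerN2.
    rewrite -[modulus x]modulusN.
    have [_ _ /(_ (- x))] := st; apply: le_trans.
    by rewrite lerNl sublinear_geN.
  + have [/asboolP h|/asboolP h] := chainA _ _ (svalP s') (svalP t).
      exists t; have [[tD _ _] _] := svalP (sval t).
      by apply: le_trans (tD x y) _; rewrite lerD2r.
    exists s'; have [[tD _ _] _] := svalP (sval s').
    by apply: le_trans (tD x y) _; rewrite lerD2l.
  + by exists s'; have [[_ tZ _] _] := svalP (sval s'); rewrite tZ.
  + by have [[_ _ t1] _] := svalP s; exact: t1.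
  have pp0 x : p x <= p0 x.
    by apply: le_trans (hp (exist _ s As) x) _; have [_] := svalP s; exact.
  exists (exist _ p (conj sp pp0)) => t At; apply/asboolP => x /=.
  exact: (hp (exist _ t At)).
- exists p; split=> // q sq qp x.
  have qp0 y : q y <= p0 y by apply: le_trans (qp y) (pp0 y).
  have /asboolP := hp (exist _ q (conj sq qp0)) (introT (asboolP _) qp).
  exact.
Qed.

(** Reducing the norm at [y] gives [q (- y) <= - modulus y], a bound inherited by every minimal
    functional below [q]. Minimality against the reduction at an arbitrary [x] makes [u] odd; with
    subadditivity this gives additivity. *)
Lemma norming_real_functional (y : F) : exists u : F -> R,
  [/\ forall x z, u (x + z) = u x + u z,
      forall (r : R) x, u (of_real r *: x) = r * u x,
      forall x, u x <= modulus x & u y = modulus y].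
Proof.
have [q [sq _ qy]] := sublinear_reduce y sublinear_modulus.
have [u [su uq umin]] := sublinear_minimal sq.
have [uD uZ u1] := su; have u0 := sublinear0 su.
have uN x : u (- x) = - u x.
  have [u' [su' u'u u'x]] := sublinear_reduce x su.
  apply/le_anti; rewrite (le_trans (umin u' su' u'u (- x)) u'x)/=.
  by rewrite lerNl sublinear_geN.
have uDE x z : u (x + z) = u x + u z.
  apply/le_anti; rewrite uD /= -lerBrDr -uN.
  by rewrite -{1}(addrK z x) uD.
exists u; split=> // [r x|].
  have [r0|r0|->] := ltgtP r 0.
  - rewrite -[of_real r *: x]opprK uN -scaleNr.
    by rewrite -(rmorphN of_real) uZ ?oppr_gt0// mulNr opprK.
  - exact: uZ.
  - by rewrite of_real0 scale0r u0 mul0r.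
apply/le_anti; rewrite u1 /= -lerN2 -uN.
exact: le_trans (uq _) qy.
Qed.

Lemma imaginary_unit_cases :
  (imaginary_unit = 0 :> K /\ forall z : K, z = of_real (real_value z)) \/
  imaginary_unit * imaginary_unit = -1 :> K.
Proof.
rewrite /imaginary_unit /of_real /real_value; case: k; [by left|right].
by rewrite -expr2 sqr_i.
Qed.

Lemma real_value_imaginary (r : R) : real_value (imaginary_unit * of_real r : K) = 0.
Proof.
rewrite /imaginary_unit /of_real /real_value; case: k => /=; rewrite mul0r//.
by rewrite mulr0 subrr.
Qed.

(** Complexification f x = u x - i u (i x); with [imaginary_unit = 0] the same formula gives [u]
    itself over the reals. The bound on the modulus follows by rotating [f x] onto the positive
    axis. *)
Theorem norming_functional (y : F) :
  exists2 f : dual F, dual_ball f & modulus y <= modulus (f y).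
Proof.
have [u [uD uZ u1 uy]] := norming_real_functional y.
pose j : K := imaginary_unit.
pose f x : K^o := of_real (u x) - j * of_real (u (j *: x)).
have fD x z : f (x + z) = f x + f z.
  by rewrite /f scalerDr !uD !of_realD mulrDr opprD addrACA.
have frZ (r : R) x : f (of_real r *: x) = of_real r * f x.
  by rewrite /f scalerA [j * of_real r]mulrC -scalerA !uZ !of_realM mulrBr [in RHS]mulrCA.
have fjZ x : f (j *: x) = j * f x.
  have [[j0 _]|jj] := imaginary_unit_cases.
    rewrite /f /j j0 !scale0r !mul0r !subr0.
    by have := uZ 0 0; rewrite scaler0 mul0r => ->; rewrite of_real0.
  rewrite /f scalerA /j jj scaleN1r mulrBr mulrA jj mulN1r opprK addrC.
  have uN1 : u (- x) = - u x.
    by have := uZ (-1) x; rewrite (rmorphN of_real) /= of_real1 scaleN1r mulN1r.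
  by rewrite uN1 (rmorphN of_real) /= mulrN opprK.
have lf : linear f.
  move=> c x z; rewrite fD; congr (_ + _); rewrite {1}(scalarE c) scalerDl fD.
  by rewrite frZ -scalerA fjZ frZ mulrA -mulrDl -scalarE.
have rf x : real_value (f x) = u x.
  by rewrite /f raddfB /= real_value_imaginary real_valueK subr0.
have f0 : f 0 = 0 by have := frZ 0 0; rewrite scaler0 of_real0 mul0r.
have f1 x : modulus (f x) <= modulus x.
  have [c [c1 hc]] := scalar_phase (f x).
  have cf : f (c *: x) = c * f x by have := lf c x 0; rewrite f0 !addr0.
  rewrite -(@real_valueK R k (modulus (f x))) -hc -cf rf (le_trans (u1 _))//.
  by rewrite modulusZ ler_piMl ?modulus_ge0.
have [|g hg] := @operator_exists R k F K^o f 1 lf; first by move=> x; rewrite mul1r.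
exists g; first by apply/dual_ballP => x; rewrite hg.
by rewrite hg -[leLHS]uy -rf (le_trans (ler_norm _))// norm_real_value.
Qed.

End HahnBanach.

Definition to_set_type (X : Type) (A : set X) (x : X) (Ax : A x) : set_type A :=
  exist (fun x => is_true (x \in A)) x (mem_set Ax).

Lemma compact_set_type (X : topologicalType) (A : set X) :
  compact A -> compact [set: set_type A].
Proof.
move=> kA H HF _.
have HA : H (set_val @^-1` A) by apply: filterS filterT => i _; exact: set_valP.
have [x [Ax hx]] := kA (set_val @ H) _ HA.
exists (to_set_type Ax); split=> // P Q HP [_ [[C oC <-] Cx CQ]].
have HP' : H (set_val @^-1` (set_val @` P)).
  by apply: filterS HP => i Pi; exists i.
have [_ [[i Pi <-] Ci]] := hx (set_val @` P) C HP' (open_nbhs_nbhs (conj oC Cx)).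
by exists i; split=> //; exact: CQ.
Qed.

(** * The interpolation space *)

Section Interpolation.
Context {R : realType} {k : scalar_kind}.
Local Notation K := (scalars R k).
Context {E F : normedModType K} (T : operator E F).

(** The terms and the sum of the series are stored in a single scalar-valued function, so that
    Tychonoff applies at once. The sum is a coordinate of its own, which makes its continuity
    automatic. *)
Definition interpolation_data := {ptws (nat * F + E) -> K^o}.
Implicit Types (m : interpolation_data) (r s : R).

Definition coordinate m (n : nat) (y : F) : K^o := m (inl (n, y)).
Definition total_value m (x : E) : K^o := m (inr x).
Definition partial m (N : nat) (y : F) : K^o := \sum_(n < N) coordinate m n y.
Definition remainder m (N : nat) (x : E) : K^o := total_value m x - partial m N (T x).

(** These vectors norm the n-th term: the first kind gives [2^-n |h_n|], the second [2^n |T^* h_n|].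
    With [u n] chosen independently for each [n], the supremum of [mass] is the sum of the
    maxima. *)
Definition test_vector (n : nat) (u : F) : Prop :=
  2 ^+ n * modulus u <= 1 \/
  exists2 x, modulus x <= 1 & u = of_real (2 ^+ n) *: T x.

Definition mass m (N : nat) (u : nat -> F) : R := \sum_(n < N) modulus (coordinate m n (u n)).

Definition linear_interpolation_data m : Prop :=
  (forall n, linear (coordinate m n)) /\ linear (total_value m).

Definition mass_le r m : Prop := forall N u,
  (forall n, test_vector n (u n)) -> mass m N u <= r.

(** The remainder stands for the rest of the series. Taking [u = 0] bounds it by [r 2^-N] on the
    unit ball, which forces [total_value] to be the sum, although each clause involves only finitely
    many coordinates and so is closed. The factor [2^N] is harmless for a true series, since
    [2^N <= 2^n] for every later term. *)
Definition weight_le r m : Prop := forall N u x,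
  (forall n, test_vector n (u n)) -> modulus x <= 1 ->
  mass m N u + modulus (remainder m N (of_real (2 ^+ N) *: x)) <= r.

(* The sequences [(h_n)] of functionals on [F], together with [sum_n h_n o T],
   such that [sum_n max (2^-n |h_n|) (2^n |h_n o T|) <= 1]. *)
Definition interpolation_set : set interpolation_data :=
  [set m | linear_interpolation_data m /\ weight_le 1 m].

Lemma pow2_gt0 n : 0 < 2 ^+ n :> R.
Proof. by rewrite exprn_gt0. Qed.

Lemma test_vector0 n : test_vector n 0.
Proof. by left; rewrite modulus0 mulr0. Qed.

Lemma lin0 (V : normedModType K) (f : V -> K^o) : linear f -> f 0 = 0.
Proof.
by move=> lf; have := lf 1 0 0; rewrite scaler0 addr0 scale1r => /eqP;
   rewrite -subr_eq0 opprD addNKr oppr_eq0 => /eqP.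
Qed.

Lemma linZ (V : normedModType K) (f : V -> K^o) : linear f ->
  forall a x, f (a *: x) = a * f x.
Proof. by move=> lf a x; have := lf a x 0; rewrite lin0// !addr0. Qed.

Lemma linear_comb (V : normedModType K) (f g : V -> K^o) (a b : K) :
  linear f -> linear g -> linear (fun x => a * f x + b * g x : K^o).
Proof.
move=> lf lg c x y; rewrite lf lg /= !mulrDr addrACA; congr (_ + _).
by rewrite scalerDr; congr (_ + _); rewrite /GRing.scale /=; ring.
Qed.

Lemma partial_linear m N : linear_interpolation_data m -> linear (partial m N).
Proof.
move=> [lm _] a x y; rewrite /partial scaler_sumr -big_split /=.
by apply: eq_bigr => n _; rewrite lm.
Qed.

Lemma remainder_linear m N : linear_interpolation_data m -> linear (remainder m N).
Proof.
move=> lm a x y; rewrite /remainder (proj2 lm) linearP (partial_linear N lm).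
by rewrite scalerBr opprD addrACA.
Qed.

Lemma mass_ge0 m N u : 0 <= mass m N u.
Proof. by apply: sumr_ge0 => n _; exact: modulus_ge0. Qed.

Lemma weight_le_mass r m : weight_le r m -> mass_le r m.
Proof.
move=> h N u hu; have := h N u 0 hu; rewrite modulus0 => /(_ ler01).
by apply: le_trans; rewrite lerDl modulus_ge0.
Qed.

Lemma coordinate_le r m n y : linear_interpolation_data m -> mass_le r m ->
  modulus (coordinate m n y) <= r * 2 ^+ n * modulus y.
Proof.
move=> [lm _] hm; apply: (linear_modulus_scale_le (f := coordinate m n)) => [s x|x x1].
  exact: linZ.
(* All the other terms are tested on 0, which isolates the n-th one. *)
pose u j : F := if j == n then of_real (2 ^+ n)^-1 *: x else 0.
have hu j : test_vector j (u j).
  rewrite /u; case: eqP => [->|_]; last exact: test_vector0.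
  left; rewrite modulusZ modulus_of_real gtr0_norm ?invr_gt0 ?pow2_gt0// mulrA.
  by rewrite divff ?mul1r// gt_eqF ?pow2_gt0.
have := hm n.+1 u hu; rewrite /mass big_ord_recr /= {2}/u eqxx.
rewrite linZ// modulusM modulus_of_real gtr0_norm ?invr_gt0 ?pow2_gt0// => h.
rewrite -ler_pdivrMr ?pow2_gt0// mulrC; apply: le_trans h.
by rewrite lerDr; exact: mass_ge0.
Qed.

Lemma total_le m x : interpolation_set m -> modulus (total_value m x) <= modulus x.
Proof.
move=> [[_ lm] hm]; rewrite -[leRHS]mul1r.
apply: (linear_modulus_scale_le (f := total_value m)) => [s y|y y1]; first exact: linZ.
have := hm 0%N (fun=> 0) y test_vector0 y1.
by rewrite /mass /remainder /partial !big_ord0 add0r subr0 expr0 of_real1 scale1r.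
Qed.

Lemma compact_interpolation_set : compact interpolation_set.
Proof.
pose c (z : nat * F + E) : R :=
  match z with inl p => 2 ^+ p.1 * modulus p.2 | inr x => modulus x end.
apply: subclosed_compact (@compact_box R k (nat * F + E)%type c) _; last first.
  move=> m hm [[n y]|x] /=; last exact: total_le.
  have [lm /weight_le_mass wm] := hm.
  by have := coordinate_le n y lm wm; rewrite mul1r.
have cc n y : continuous (fun m : interpolation_data => coordinate m n y) by exact: continuous_ptws_eval.
have ct x : continuous (fun m : interpolation_data => total_value m x) by exact: continuous_ptws_eval.
have clin (V : normedModType K) (e : interpolation_data -> V -> K^o) :
    (forall v, continuous (fun m => e m v)) -> closed [set m | linear (e m)].
  move=> ce; apply: closed_forall => a; apply: closed_forall => x.
  apply: closed_forall => y; apply: closed_eq_continuous; first exact: ce.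
  by apply: continuous_scalarD; [exact: continuous_scalarM|exact: ce].
apply: closedI; first (apply: closedI; last exact: clin).
  by apply: closed_forall => n; exact: clin.
apply: closed_forall => N; apply: closed_forall => u; apply: closed_forall => x.
apply: closed_imply; apply: closed_imply; apply: closed_le_continuous.
apply: (continuous_realD (f := fun m => mass m N u)).
  apply: (continuous_real_sum (f := fun n m => modulus (coordinate m n (u n)))) => n.
  exact: continuous_modulus_comp.
apply: (continuous_modulus_comp (f := fun m => remainder m N (of_real (2 ^+ N) *: x))).
apply: continuous_scalarB => //.
exact: (continuous_scalar_sum (f := fun n m => coordinate m n _)).
Qed.

End Interpolation.

(** * The points of the interpolation set as functionals on [E] *)

Section InterpolationFamily.
Context {R : realType} {k : scalar_kind}.
Local Notation K := (scalars R k).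
Context {E F : normedModType K} (T : operator E F).
Implicit Types (m : @interpolation_data R k E F) (r s : R).

Definition data_comb (a b : K) m m' : @interpolation_data R k E F := fun z => a * m z + b * m' z.

Lemma partial_comb (a b : K) m m' N y :
  partial (data_comb a b m m') N y = a * partial m N y + b * partial m' N y.
Proof. by rewrite /partial !mulr_sumr -big_split. Qed.

Lemma remainder_comb (a b : K) m m' N x :
  remainder T (data_comb a b m m') N x =
  a * remainder T m N x + b * remainder T m' N x.
Proof. by rewrite /remainder partial_comb !mulrBr opprD addrACA. Qed.

Lemma linear_data_comb (a b : K) m m' :
  linear_interpolation_data m -> linear_interpolation_data m' -> linear_interpolation_data (data_comb a b m m').
Proof.
move=> [cm tm] [cm' tm']; split=> [n|]; first exact: (linear_comb a b (cm n) (cm' n)).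
exact: (linear_comb a b tm tm').
Qed.

Lemma weight_le_comb (a b : K) r s m m' : weight_le T r m -> weight_le T s m' ->
  weight_le T (modulus a * r + modulus b * s) (data_comb a b m m').
Proof.
move=> hm hm' N u x hu x1.
have h := hm N u x hu x1; have h' := hm' N u x hu x1.
apply: le_trans (lerD (ler_wpM2l (modulus_ge0 a) h) (ler_wpM2l (modulus_ge0 b) h')).
rewrite !mulrDr addrACA; apply: lerD; last first.
  by rewrite remainder_comb -!modulusM ler_modulusD.
rewrite /mass !mulr_sumr -big_split /=; apply: ler_sum => n _.
by rewrite -!modulusM ler_modulusD.
Qed.

Lemma zero_interpolation : interpolation_set T (fun=> 0).
Proof.
split; first by split=> [n|] a x y; rewrite /coordinate /total_value scaler0 addr0.
move=> N u x _ _; rewrite /mass /remainder /partial /total_value /coordinate.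
rewrite !big1 ?subr0 ?modulus0 ?addr0//= => n _; exact: modulus0.
Qed.

Let point : set_type (interpolation_set T) := to_set_type zero_interpolation.

Let mem_point (i : set_type (interpolation_set T)) : interpolation_set T (set_val i).
Proof. exact: set_valP. Qed.

Let family_linear (i : set_type (interpolation_set T)) : linear (total_value (set_val i)).
Proof. by case: (mem_point i) => -[]. Qed.

Let family_le (i : set_type (interpolation_set T)) x :
  modulus (total_value (set_val i) x) <= modulus x.
Proof. exact: total_le (mem_point i). Qed.

Definition interpolation_family : functional_family E :=
  @FunctionalFamily R k E (set_type (interpolation_set T)) point
    (fun i => total_value (set_val i)) family_linear family_le.
Local Notation l := interpolation_family.

Definition data_of (i : family_index l) : @interpolation_data R k E F := set_val i.

Lemma data_ofP (i : family_index l) : interpolation_set T (data_of i).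
Proof. exact: mem_point. Qed.

Lemma compact_family : compact [set: family_index l].
Proof. exact/compact_set_type/compact_interpolation_set. Qed.

Lemma continuous_data_of z : continuous (fun i : family_index l => data_of i z : K^o).
Proof.
move=> i; apply: (@continuous_comp _ _ _ set_val (fun m : @interpolation_data R k E F => m z)).
  exact: initial_continuous.
exact: continuous_ptws_eval.
Qed.

Lemma weight_le_point s m : linear_interpolation_data m -> 0 < s -> weight_le T s m ->
  exists i : family_index l, forall x, total_value m x = of_real s * l i x.
Proof.
move=> lm s0 hm; pose m' := data_comb (of_real s^-1) 0 m m.
have m'P : interpolation_set T m'.
  split; first exact: linear_data_comb.
  have := @weight_le_comb (of_real s^-1) 0 _ _ _ _ hm hm.
  by rewrite modulus0 mul0r addr0 modulus_of_real gtr0_norm ?invr_gt0// mulVf// gt_eqF.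
exists (to_set_type m'P) => x.
have -> : l (to_set_type m'P) x = of_real s^-1 * m (inr x) + 0 * m (inr x) by [].
by rewrite mul0r addr0 mulrA -of_realM divff ?gt_eqF// of_real1 mul1r.
Qed.

Lemma family_absolutely_convex (i j : family_index l) (a b : K) :
  modulus a + modulus b <= 1 ->
  exists i', forall x, l i' x = a * l i x + b * l j x.
Proof.
move=> ab; have [lm wm] := data_ofP i; have [lm' wm'] := data_ofP j.
have mP : interpolation_set T (data_comb a b (data_of i) (data_of j)).
  split; first exact: linear_data_comb.
  move=> N u x hu x1; apply: le_trans ab.
  by have h := @weight_le_comb a b _ _ _ _ wm wm'; have := h N u x hu x1; rewrite !mulr1.
by exists (to_set_type mP).
Qed.

(** The series whose only term is [f], in position [p]: the last two conditions say that [2^-p |f|]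
    and [2^p |T^* f|] are at most [s]. The position 0 will give the factorization, a large [p] the
    interpolation estimate. *)
Lemma one_coordinate_point (f : F -> K^o) (c d s : R) (p : nat) : linear f ->
  (forall y, modulus (f y) <= c * modulus y) ->
  (forall x, modulus (f (T x)) <= d * modulus x) ->
  0 < s -> 0 <= d -> c <= 2 ^+ p * s -> 2 ^+ p * d <= s ->
  exists i : family_index l, forall x, f (T x) = of_real s * l i x.
Proof.
move=> lf fc fd s0 d0 cp dp.
pose m : @interpolation_data R k E F := fun z => match z with
  | inl ny => if ny.1 == p then f ny.2 else 0 | inr x => f (T x) end.
have lm : linear_interpolation_data m.
  split=> [n a x y|a x y]; rewrite /coordinate /total_value /=; last by rewrite linearP lf.
  by case: eqP => _; [exact: lf|rewrite scaler0 addr0].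
apply: (@weight_le_point s m lm s0) => N u x hu x1.
have rs : 0 <= s by exact: ltW.
(* Up to [p] the functional is still entirely in the remainder; beyond [p] it is entirely in the
   mass. *)
have [Np|pN] := leqP N p.
  rewrite /mass /remainder /partial !big1; last 2 first.
  - by move=> n _; rewrite /coordinate /= ltn_eqF// (leq_trans (ltn_ord n)).
  - by move=> n _; rewrite /coordinate /= ltn_eqF ?modulus0// (leq_trans (ltn_ord n)).
  rewrite add0r subr0 /total_value /= (le_trans (fd _))//.
  rewrite modulusZ modulus_of_real gtr0_norm ?pow2_gt0//.
  apply: le_trans dp; rewrite mulrCA; apply: ler_pM => //.
  + by rewrite mulr_ge0 ?modulus_ge0.
  + by rewrite ler_weXn2l// ler1n.
  + by rewrite ler_piMr.
have sumE (V : zmodType) (g : nat -> V) (pN' : (p < N)%N) :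
    \sum_(n < N) (if n == p :> nat then g n else 0) = g p.
  by rewrite -big_mkcond (big_pred1 (Ordinal pN')).
have -> : remainder T m N (of_real (2 ^+ N) *: x) = 0.
  rewrite /remainder /partial /coordinate /total_value /=.
  by rewrite (sumE _ (fun=> f (T (of_real (2 ^+ N) *: x))))// subrr.
have -> : mass m N u = modulus (f (u p)).
  rewrite /mass /coordinate /= -(sumE _ (fun n => modulus (f (u n))))//.
  by apply: eq_bigr => n _; case: eqP => // _; rewrite modulus0.
rewrite modulus0 addr0; have [up|[z z1 ->]] := hu p.
  rewrite (le_trans (fc _))//; apply: (@le_trans _ _ (2 ^+ p * s * modulus (u p))).
    by rewrite ler_wpM2r ?modulus_ge0.
  by rewrite mulrAC ler_piMl.
rewrite linZ// modulusM modulus_of_real gtr0_norm ?pow2_gt0//.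
apply: le_trans dp; rewrite ler_wpM2l ?(ltW (pow2_gt0 _ _))// (le_trans (fd _))//.
by rewrite ler_piMr.
Qed.

End InterpolationFamily.

(** * Tails of the series *)

Section InterpolationTail.
Context {R : realType} {k : scalar_kind}.
Local Notation K := (scalars R k).
Context {E F : normedModType K} (T : operator E F).
Implicit Types (m : @interpolation_data R k E F) (r s : R).
Local Notation l := (interpolation_family T).

Lemma pow2_archimedean (c s : R) : 0 < s -> exists d, c <= 2 ^+ d * s.
Proof.
move=> s0; exists (Num.bound (c / s)); rewrite -ler_pdivrMr//.
exact/ltW/upper_nthrootP.
Qed.

Lemma massS m N u : mass m N.+1 u = mass m N u + modulus (coordinate m N (u N)).
Proof. exact: big_ord_recr. Qed.

Lemma partialS m N y : partial m N.+1 y = partial m N y + coordinate m N y.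
Proof. exact: big_ord_recr. Qed.

Lemma remainderS m N x :
  remainder T m N x = coordinate m N (T x) + remainder T m N.+1 x.
Proof. by rewrite /remainder partialS opprD addrCA subrKC. Qed.

Lemma eq_mass m N u v : (forall n, (n < N)%N -> u n = v n) -> mass m N u = mass m N v.
Proof. by move=> uv; apply: eq_bigr => n _; rewrite uv. Qed.

(** Moves the term [N] from the remainder into the mass, which is possible because [2^N T x] is a
    test vector at [N]. What is left has the prefactor [2^(N+1)], so its argument is halved. *)
Lemma weight_step m N u x : linear_interpolation_data m ->
  (forall n, test_vector T n (u n)) -> modulus x <= 1 ->
  exists2 v, forall n, test_vector T n (v n) &
    mass m N u + modulus (remainder T m N (of_real (2 ^+ N) *: x)) <=
    mass m N.+1 v +
    modulus (remainder T m N.+1 (of_real (2 ^+ N.+1) *: (of_real 2^-1 *: x))).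
Proof.
move=> lm hu x1.
exists (fun n => if (n < N)%N then u n else of_real (2 ^+ n) *: T x) => [n|].
  by case: ifP => _; [exact: hu|right; exists x].
rewrite scalerA -of_realM exprSr -mulrA mulfV// mulr1 remainderS.
rewrite massS ltnn linearZ -addrA; apply: lerD.
  rewrite le_eqVlt; apply/orP; left; apply/eqP.
  by apply: eq_bigr => n _; rewrite ltn_ord.
exact: ler_modulusD.
Qed.

Lemma weight_steps m d N u x : linear_interpolation_data m ->
  (forall n, test_vector T n (u n)) -> modulus x <= 1 ->
  exists N' v z, [/\ forall n, test_vector T n (v n), modulus z <= (2 ^+ d)^-1 &
    mass m N u + modulus (remainder T m N (of_real (2 ^+ N) *: x)) <=
    mass m N' v + modulus (remainder T m N' (of_real (2 ^+ N') *: z))].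
Proof.
move=> lm hu x1; elim: d => [|d [N' [v [z [hv hz hle]]]]].
  by exists N, u, x; rewrite expr0 invr1.
have z1 : modulus z <= 1.
  by rewrite (le_trans hz)// invf_le1 ?pow2_gt0// exprn_ege1// ler1n.
have [w hw hle'] := weight_step N' lm hv z1.
exists N'.+1, w, (of_real 2^-1 *: z); split=> //; last exact: le_trans hle hle'.
rewrite modulusZ modulus_of_real gtr0_norm ?invr_gt0// exprS invfM.
by rewrite ler_wpM2l ?invr_ge0.
Qed.

Lemma remainder_le m N z : interpolation_set T m ->
  modulus (remainder T m N (of_real (2 ^+ N) *: z)) <= modulus z.
Proof.
move=> [lm wm]; have lr := remainder_linear T N lm; rewrite -[leRHS]mul1r.
apply: (linear_modulus_scale_le (f := fun z => remainder T m N (of_real (2 ^+ N) *: z))).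
  by move=> s x; rewrite !(linZ lr) mulrCA.
move=> x x1; apply: le_trans (wm N (fun=> 0) x (test_vector0 T) x1).
by rewrite lerDr mass_ge0.
Qed.

(* The remainder is absorbed by the test vectors [2^n T x], up to [2^-d]. *)
Lemma mass_le_weight r m : interpolation_set T m -> mass_le T r m -> weight_le T r m.
Proof.
move=> hm mm N u x hu x1; apply/ler_addgt0Pr => e e0.
have [d hd] := pow2_archimedean 1 e0.
have [N' [v [z [hv hz hle]]]] := weight_steps d N (proj1 hm) hu x1.
apply: le_trans hle _; apply: lerD; first exact: mm.
apply: le_trans (remainder_le N' z hm) _; apply: le_trans hz _.
by rewrite -[leLHS]mulr1 ler_pdivrMl ?pow2_gt0.
Qed.

(** A head that uses up [r - s] of a total mass [r] leaves at most [s] to the tail, that is, to the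
    series with its first [N] terms replaced by 0. *)
Lemma remainder_point m r s N u : interpolation_set T m -> mass_le T r m ->
  (forall n, test_vector T n (u n)) -> 0 < s -> r - s <= mass m N u ->
  exists i : family_index l, forall x, remainder T m N x = of_real s * l i x.
Proof.
move=> hm mm hu s0 hs; have wm := mass_le_weight hm mm.
have [lm _] := hm; have [lc _] := lm.
pose t : @interpolation_data R k E F := fun z => match z with
  | inl ny => if (ny.1 < N)%N then 0 else m (inl ny)
  | inr x => remainder T m N x end.
have lt : linear_interpolation_data t.
  split=> [n a x y|]; last exact: remainder_linear.
  by rewrite /coordinate /=; case: ifP => _; [rewrite scaler0 addr0|exact: lc].
have head n y : (n < N)%N -> coordinate t n y = 0 by rewrite /coordinate /= => ->.
have tail n y : (N <= n)%N -> coordinate t n y = coordinate m n y.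
  by rewrite /coordinate /= ltnNge => ->.
have partial_t y d : partial m (N + d) y = partial m N y + partial t (N + d) y.
  elim: d => [|d IH].
    by rewrite addn0 {3}/partial big1 ?addr0// => n _; rewrite head.
  by rewrite addnS !partialS IH tail ?leq_addr// addrA.
have remainder_t x d : remainder T t (N + d) x = remainder T m (N + d) x.
  by rewrite /remainder partial_t opprD addrA.
(* Test vectors may be spliced, [u] before [N] and [v] after, since each position is tested
   independently. *)
have mass_t v d : mass m (N + d) (fun n => if (n < N)%N then u n else v n) =
    mass m N u + mass t (N + d) v.
  elim: d => [|d IH].
    rewrite addn0 [mass t _ _]big1 ?addr0; last by move=> n _; rewrite head// modulus0.
    by apply: eq_mass => n ->.
  rewrite addnS !massS IH.
  by rewrite ltnNge leq_addr /= tail ?leq_addr// addrA.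
have late d v x : (forall n, test_vector T n (v n)) -> modulus x <= 1 ->
    mass t (N + d) v + modulus (remainder T t (N + d) (of_real (2 ^+ (N + d)) *: x)) <= s.
  move=> hv x1.
  have [|h] := pselect (forall n, test_vector T n (if (n < N)%N then u n else v n));
    last by case: h => n; case: ifP.
  move=> /(wm (N + d)%N _ x)/(_ x1); rewrite mass_t remainder_t.
  by move: hs; lra.
apply: (@weight_le_point _ _ _ _ T s t lt s0) => J v x hv x1.
have [NJ|JN] := leqP N J; first by rewrite -(subnKC NJ) late.
rewrite /mass /remainder /partial !big1; last 2 first.
- by move=> n _; rewrite head// (ltn_trans (ltn_ord n)).
- by move=> n _; rewrite head ?modulus0// (ltn_trans (ltn_ord n)).
rewrite add0r subr0.
(* Before [N] the tail has no mass, so only its total counts: write [2^J x] as [2^N x'] and use the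
   bound at [N]. *)
pose x' := of_real (2 ^+ J / 2 ^+ N) *: x.
have x'1 : modulus x' <= 1.
  rewrite modulusZ modulus_of_real gtr0_norm ?divr_gt0 ?pow2_gt0//.
  rewrite mulr_ile1 ?modulus_ge0 ?divr_ge0 ?(ltW (pow2_gt0 _))//.
  by rewrite ler_pdivrMr ?pow2_gt0// mul1r ler_weXn2l ?ler1n// ltnW.
have := late 0%N (fun=> 0) x' (test_vector0 T) x'1.
rewrite addn0 /x' scalerA -of_realM mulrC divfK ?gt_eqF ?pow2_gt0//.
rewrite -{2}[N]addn0 remainder_t addn0; apply: le_trans.
by rewrite lerDr mass_ge0.
Qed.

End InterpolationTail.

(** * Derivations of the dual ball of the interpolation space *)

Section InterpolationSpace.
Context {R : realType} {k : scalar_kind}.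
Local Notation K := (scalars R k).
Context {E F : normedModType K} (T : operator E F).
Local Notation l := (interpolation_family T).
Local Notation G := (completion l).

Lemma partial_le (m : @interpolation_data R k E F) N y :
  interpolation_set T m -> modulus (partial m N y) <= 2 ^+ N * modulus y.
Proof.
move=> [lm wm]; have mm := weight_le_mass wm.
elim: N => [|N IH].
  by rewrite /partial big_ord0 modulus0 mulr_ge0 ?modulus_ge0// ltW// pow2_gt0.
rewrite partialS (le_trans (ler_modulusD _ _))//.
have := coordinate_le N y lm mm; rewrite mul1r exprS mulr_natl mulr2n mulrDl.
exact: lerD.
Qed.

(** The terms of a point satisfy [|h_n| <= 2^n], so the head has norm at most [2^N]; dividing by
    [2^N] puts it into the unit ball of [F^*], and its adjoint into [K]. *)
Lemma head_functional_exists N (i : family_index l) :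
  exists f : dual F, forall y, f y = of_real (2 ^+ N)^-1 * partial (data_of i) N y.
Proof.
have hi := data_ofP i; have lp := partial_linear N (proj1 hi).
apply: (@operator_exists R k F K^o _ 1) => [a x y|y].
  by rewrite lp mulrDr mulrCA.
rewrite modulusM modulus_of_real gtr0_norm ?invr_gt0 ?pow2_gt0//.
by rewrite ler_pdivrMl ?pow2_gt0// mul1r partial_le.
Qed.

Definition head_functional N (i : family_index l) : dual F := projT1 (cid (head_functional_exists N i)).

Lemma head_functionalE N i y : head_functional N i y = of_real (2 ^+ N)^-1 * partial (data_of i) N y.
Proof. exact: (projT2 (cid (head_functional_exists N i))). Qed.

Lemma partialE N i y : partial (data_of i) N y = of_real (2 ^+ N) * head_functional N i y.
Proof. by rewrite head_functionalE mulrA -of_realM divff ?of_real1 ?mul1r// gt_eqF ?pow2_gt0. Qed.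

Lemma head_functional_ball N i : dual_ball (head_functional N i).
Proof.
apply/dual_ballP => y; rewrite head_functionalE modulusM modulus_of_real.
rewrite gtr0_norm ?invr_gt0 ?pow2_gt0// ler_pdivrMl ?pow2_gt0//.
exact/partial_le/data_ofP.
Qed.

Lemma continuous_adjoint_head N :
  continuous (fun i => adjoint T (head_functional N i) : weak_star_topology E).
Proof.
apply: continuous_weak_star => x.
under eq_fun do rewrite [adjoint _ _ _]head_functionalE.
apply: continuous_scalarM.
apply: (continuous_scalar_sum (f := fun n i => coordinate (data_of i) n (T x))) => n.
exact: continuous_data_of.
Qed.

(* Interpolation: [f] below has norm at most [2^(N+1)] on [F], so it is [s]-small
   in the dual of [G] as soon as [f o T] is small enough. *)
Lemma heads_far (s : R) (N : nat) : 0 < s -> exists2 d : R, 0 < d &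
  forall r i j u v, mass_le T r (data_of i) -> mass_le T r (data_of j) ->
  (forall n, test_vector T n (u n)) -> (forall n, test_vector T n (v n)) ->
  r - s <= mass (data_of i) N u -> r - s <= mass (data_of j) N v ->
  dual_norm (fun x => adjoint T (head_functional N i) x - adjoint T (head_functional N j) x) <= d ->
  dual_norm (fun g : G => point_functional i g - point_functional j g) <= 3 * s.
Proof.
move=> s0; have [p hp] := pow2_archimedean (2 ^+ N.+1) s0.
(* Position [p] absorbs the norm [2^(N+1)] of [f] provided that [f o T] has norm at most [s / 2^p];
   the last factor undoes the normalisation of the heads. *)
pose d : R := s / 2 ^+ p / 2 ^+ N.
have d0 : 0 < d by rewrite !divr_gt0 ?pow2_gt0.
exists d => // r i j u v mi mj hu hv hi hj hd.
have [a ha] := remainder_point (data_ofP i) mi hu s0 hi.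
have [b hb] := remainder_point (data_ofP j) mj hv s0 hj.
pose f y : K^o := partial (data_of i) N y - partial (data_of j) N y.
have lf : linear f.
  move=> c x y; rewrite /f (partial_linear N (proj1 (data_ofP i))).
  by rewrite (partial_linear N (proj1 (data_ofP j))) scalerBr opprD addrACA.
have fy y : modulus (f y) <= 2 ^+ N.+1 * modulus y.
  rewrite (le_trans (ler_modulusB _ _))// exprS mulr_natl mulr2n mulrDl.
  by apply: lerD; exact/partial_le/data_ofP.
have fT x : modulus (f (T x)) <= s / 2 ^+ p * modulus x.
  apply: (linear_modulus_scale_le (f := fun x => f (T x))) => [c z|z z1].
    by rewrite linearZ (linZ lf).
  rewrite /f !partialE -mulrBr modulusM modulus_of_real gtr0_norm ?pow2_gt0//.
  rewrite -ler_pdivlMl ?pow2_gt0// mulrC; apply: le_trans hd.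
  exact: (@le_dual_norm_sub _ _ _ (adjoint T (head_functional N i)) (adjoint T (head_functional N j))).
have [||c hc] := one_coordinate_point lf fy fT s0 _ hp.
- by rewrite divr_ge0 ?ltW ?pow2_gt0.
- by rewrite mulrC divfK// gt_eqF ?pow2_gt0.
have s3 : 0 <= 3 * s by rewrite mulr_ge0 ?ltW.
apply: dual_norm_le => g g1; rewrite !point_functionalE.
rewrite (@le_trans _ _ (3 * s * modulus g)) ?ler_piMr//.
apply: functional_dist => // x hx.
(* Difference of heads plus two remainders: each of the three is [s] times a point of the family,
   whence [3 * s]. *)
have -> : l i x - l j x = f (T x) + (remainder T (data_of i) N x - remainder T (data_of j) N x).
  have cancel (V : zmodType) (y y' z z' : V) :
      z - z' = (y - y') + ((z - y) - (z' - y')).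
    by rewrite opprB addrCA !subrKA.
  exact: cancel.
rewrite hc ha hb (le_trans (ler_modulusD _ _))//.
apply: le_trans (lerD (lexx _) (ler_modulusB _ _)) _.
have bound e : modulus (of_real s * l e x) <= s.
  by rewrite modulusM modulus_of_real gtr0_norm// ler_piMr// ltW.
have := bound a; have := bound b; have := bound c; lra.
Qed.

Definition mass_ball (r : R) : set (family_index l) := [set i | mass_le T r (data_of i)].

Definition point_far (e : R) (i j : family_index l) : Prop :=
  e < dual_norm (fun g : G => point_functional i g - point_functional j g).

Section Drop.
Variables (a : Ord)
  (Ka : forall d : R, 0 < d -> derived (far d)
     (adjoint T @` @dual_ball R k F : set (weak_star_topology E)) a = set0).

(** A survivor of mass above [r - s] would have this witnessed by some [N] and [u], hence on a whole
    neighbourhood. There the heads of far points are [d]-far, so the head of the survivor would lie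
    in the [a]-th derived set of [K]. As [d] depends on [N], that set must be empty for every
    [d]. *)
Lemma derived_mass_ball (r s : R) : 0 < s ->
  derived (point_far (3 * s)) (mass_ball r) a `<=` mass_ball (r - s).
Proof.
move=> s0 i hi N u hu; rewrite leNgt; apply/negP => hs.
have [d d0 hd] := heads_far N s0.
pose V := [set j : family_index l | r - s < mass (data_of j) N u].
have oV : open V.
  apply: open_gt_continuous.
  apply: (continuous_real_sum (f := fun n j => modulus (coordinate (data_of j) n (u n)))).
  by move=> n; apply: continuous_modulus_comp; exact: continuous_data_of.
have : derived (far d) (adjoint T @` @dual_ball R k F : set (weak_star_topology E)) a
    (adjoint T (head_functional N i)).
  apply: (derived_transfer (continuous_adjoint_head (N := N)) oV) hi hs.
  - by move=> j _ _; exists (head_functional N j) => //; exact: head_functional_ball.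
  - move=> j j' Sj Vj Sj' Vj'; rewrite /point_far /far !ltNge; apply: contra.
    by apply: (hd r j j' u u) => //; exact: ltW.
by rewrite Ka.
Qed.

Lemma derived_mass_ball_iter (s : R) (J : nat) : 0 < s ->
  derived (point_far (3 * s)) setT (omul a (iter J OSucc OZero)) `<=`
  mass_ball (1 - J%:R * s).
Proof.
move=> s0; elim: J => [|J IH] /=.
  by move=> i _; rewrite mul0r subr0; apply: weight_le_mass; case: (data_ofP i).
rewrite derived_oadd => i /(@derived_subset _ _ _ _ a IH)/(derived_mass_ball s0).
by rewrite -natr1 mulrDl mul1r opprD addrA.
Qed.

Lemma szlenk_interpolation (e : R) : 0 < e -> exists J : nat,
  szlenk_iter e (@dual_ball R k G) (omul a (iter J OSucc OZero)) = set0.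
Proof.
(* [3 * s] is [e / 2]: passing to the image under [point_functional] halves the distance. *)
move=> e0; pose s := e / 6; have s0 : 0 < s by exact: divr_gt0.
exists (Num.bound s^-1); rewrite szlenk_iterE -subset0.
set b := omul _ _ => f hf.
have cI : compact [set: family_index l] by exact: (@compact_family _ _ _ _ T).
have cl x : continuous (fun i => l i x) by exact: continuous_data_of.
have : (point_functional (l := l) @` derived (point_far (3 * s)) setT b) f.
  apply: (@derived_image _ (weak_star_topology G) (point_functional (l := l))
    (point_far (3 * s)) (far e)) => //.
  - exact: continuous_point_functional.
  - exact: weak_star_hausdorff.
  - move=> x x' z z'; rewrite /far /point_far => ff zz'.
    have [h|h] := ltP (3 * s)
      (dual_norm (fun g : G => point_functional x g - point_functional z g)).
      by left.
    right; rewrite -zz'; move: ff h (dual_norm_sub_triangle (point_functional x)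
      (point_functional z) (point_functional x')); rewrite /s; lra.
  - apply: derived_subset hf => g gb.
    have [i ->] := dual_ball_point cI cl (family_absolutely_convex (T := T)) gb.
    by exists i.
move=> [i /(derived_mass_ball_iter s0) hi _].
(* The empty sum has mass 0, while [1 - J s] is negative because [J] exceeds the inverse of [s]. *)
have := hi 0%N (fun=> 0) (test_vector0 T); rewrite /mass big_ord0 subr_ge0.
rewrite -ler_pdivlMr// mul1r leNgt => /negP[].
by rewrite archi_boundP// invr_ge0 ltW.
Qed.

End Drop.

End InterpolationSpace.

(** * Factorization *)

Section Factorization.
Context {R : realType} {k : scalar_kind}.
Local Notation K := (scalars R k).

Lemma derived_far_le (E : normedModType K) (d e : R) (S : set (weak_star_topology E)) a :
  d <= e -> derived (far e) S a `<=` derived (far d) S a.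
Proof.
move=> de f hf; apply: (@derived_transfer _ _ id (far e) _ S setT) hf _ => //.
- by move=> ?; exact: cvg_id.
- exact: openT.
- by move=> g h _ _ _ _; exact: le_lt_trans.
Qed.

Lemma Sz_operator_uniform (E F : normedModType K) (T : operator E F) (alpha : Ord) :
  uncountable_cofinality alpha -> index_le (Sz_operator T) (omega_pow alpha) ->
  exists2 b, olt b alpha & forall d : R, 0 < d ->
    derived (far d) (adjoint T @` @dual_ball R k F : set (weak_star_topology E))
      (omega_pow b) = set0.
Proof.
move=> ha hT; pose S : set (weak_star_topology E) := adjoint T @` @dual_ball R k F.
have kS : compact S by exact: compact_adjoint_image.
have cS : closed S by exact: compact_closed weak_star_hausdorff kS.
have S0 : S !=set0.
  have [f fb _] := norming_functional (0 : F).
  by exists (adjoint T f), f.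
have step (n : nat) : exists g, olt g alpha /\
    derived (far (n.+1%:R^-1 : R)) S (omega_pow g) = set0.
  (* Otherwise omega^alpha would belong to the index, hence be smaller than itself. *)
  have empty : derived (far (n.+1%:R^-1 : R)) S (omega_pow alpha) = set0.
    have [//|/eqP/set0P ne] := pselect (derived (far (n.+1%:R^-1 : R)) S (omega_pow alpha) = set0).
    case: (@oltnn (omega_pow alpha)); apply: hT; exists n.+1%:R^-1.
      by rewrite invr_gt0.
    by rewrite /Sz_eps szlenk_iterE.
  have [b hb b0] := derived_eq0_succ kS cS S0 empty.
  have [g hg bg] := olt_omega_pow ha hb.
  exists g; split=> //; rewrite -subset0 -b0; exact: derived_antitone.
have [g hg] := choice step.
have [b hb gb] := uncountable_cofinality_bound ha (fun n => proj1 (hg n)).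
exists b => // d d0; rewrite -subset0.
have [n hn] : exists n : nat, n.+1%:R^-1 <= d.
  exists (Num.bound d^-1); rewrite invf_ple ?posrE// ltW// (lt_trans (archi_boundP _))//.
  by rewrite invr_ge0 ltW.
  by rewrite ltr_nat.
apply: subset_trans (derived_far_le hn) _; rewrite -(proj2 (hg n)).
exact/derived_antitone/ole_omega_pow.
Qed.

Lemma interpolation_factorization (E F : completeNormedModType K) (T : operator E F) :
  exists B : operator (completion (interpolation_family T)) F,
    T = op_comp B (completion_map (interpolation_family T)).
Proof.
have [d d0 hd] := operator_modulus_bound T.
(* In position 0 a functional of norm at most 1 on [F], and at most [d] after composition with [T],
   is [s] times a point as soon as [s] bounds both. Applied to a functional norming [T x], this
   bounds [T x] by [s] times the seminorm of [x]. *)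
pose s := Num.max 1 d; have s0 : 0 < s by rewrite lt_max ltr01.
have [||B hB] := @operator_extension R k E (completion (interpolation_family T)) F
    (completion_map (interpolation_family T)) T s (ltW s0).
- exact: completion_map_dense.
- move=> x; have [f /dual_ballP f1 fx] := norming_functional (T x).
  have fT z : modulus (f (T z)) <= d * modulus z by apply: le_trans (f1 _) (hd z).
  have [y|||i hi] := @one_coordinate_point R k E F T f 1 d s 0 (linearP f) _ fT s0 d0.
  + by rewrite mul1r.
  + by rewrite expr0 mul1r le_max lexx.
  + by rewrite expr0 mul1r le_max lexx orbT.
  rewrite (le_trans fx)// hi modulusM modulus_of_real gtr0_norm// ler_pM2l//.
  by rewrite -completion_mapE le_modulus_completion.
by exists B; apply: operator_ext => x; rewrite /= hB.
Qed.

Lemma Sz_interpolation (E F : completeNormedModType K) (T : operator E F) (alpha : Ord) :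
  uncountable_cofinality alpha -> index_le (Sz_operator T) (omega_pow alpha) ->
  index_le (Sz_space (completion (interpolation_family T))) (omega_pow alpha).
Proof.
move=> ha hT; have [b hb Kb] := Sz_operator_uniform ha hT.
move=> c [e e0 ne]; have [J hJ] := szlenk_interpolation Kb e0.
have cJ : olt c (omul (omega_pow b) (iter J OSucc OZero)).
  apply: oleNgt => Jc; case: ne => f; rewrite szlenk_iterE.
  by move/(derived_antitone Jc); rewrite -szlenk_iterE hJ.
apply: ole_trans cJ _; apply: (@ole_trans (omega_pow (OSucc b))).
  by apply: (@ole_supr _ _ _ _ J); exact: ole_refl.
(* By definition of [olt], [hb] says that [b + 1 <= alpha], which absorbs the extra power of
   [omega]. *)
exact: ole_omega_pow.
Qed.

Lemma Sz_operator_id (G : normedModType K) : Sz_operator (op_id G) = Sz_space G.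
Proof.
rewrite /Sz_operator /Sz_space; congr Sz; apply/seteqP; split=> [_ [f fb <-]|f fb].
  by rewrite (_ : adjoint _ f = f)//; exact: operator_ext.
by exists f => //; exact: operator_ext.
Qed.

End Factorization.

Theorem corollary4p8 (R : realType) (k : scalar_kind) (alpha : Ord)
    (halpha : uncountable_cofinality alpha) :
  factorization_property (SZ R k alpha) /\
  (forall (E F : completeNormedModType (scalars R k)) (T : operator E F),
     index_le (Sz_operator T) (omega_pow alpha) ->
     exists (G : completeNormedModType (scalars R k))
       (A : operator E G) (B : operator G F),
       index_le (Sz_space G) (omega_pow alpha) /\ T = op_comp B A).
Proof.
have main (E F : completeNormedModType (scalars R k)) (T : operator E F) :
     index_le (Sz_operator T) (omega_pow alpha) ->
     exists (G : completeNormedModType (scalars R k))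
       (A : operator E G) (B : operator G F),
       index_le (Sz_space G) (omega_pow alpha) /\ T = op_comp B A.
  move=> hT; have [B hB] := interpolation_factorization T.
  exists (completion (interpolation_family T)),
    (completion_map (interpolation_family T)), B; split=> //.
  exact: Sz_interpolation.
split=> // E F T /main[G [A [B [hG hT]]]].
by exists G, A, B; split=> //; rewrite /SZ Sz_operator_id.
Qed.
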